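(* Let $\mathcal C$ be a small category and let $R\colon\mathcal C\to\mathrm{Ring}$ be a strict representation. Then every $M\in\mathrm{Mod}_{\mathrm{cart}}(R)$ has a pure-injective envelope.
   Context: $\mathrm{Ring}$ is the category of unitary associative (not necessarily commutative) rings. A strict representation $R\colon\mathcal C\to\mathrm{Ring}$ is a functor $c\mapsto R_c$, $\alpha\mapsto R_\alpha$. A right $R$-module $M$ consists of a right $R_c$-module $M_c$ for each object $c$ of $\mathcal C$ and an $R_c$-linear map $M_\alpha\colon M_c\to\alpha^*M_d$ for each $\alpha\colon c\to d$ (where $\alpha^*$ is restriction of scalars along $R_\alpha$), with $M_{\beta\alpha}=\alpha^*(M_\beta)\circ M_\alpha$ and $M_{\mathrm{id}_c}=\mathrm{id}$; morphisms are families of linear maps commuting with the structure maps. $M$ is cartesian if for every $\alpha\colon c\to d$ the adjoint morphism $M_c\otimes_{R_c}R_d\to M_d$ is an isomorphism. $\mathrm{Mod}_{\mathrm{cart}}(R)$ is the category of cartesian right $R$-modules. A short exact sequence $0\to N\to M\to L\to0$ in $\mathrm{Mod}_{\mathrm{cart}}(R)$ is pure-exact if $0\to N_c\to M_c\to L_c\to0$ is a pure-exact sequence of right $R_c$-modules (i.e. it stays exact after tensoring with any left $R_c$-module) for all $c\in\mathrm{Ob}\,\mathcal C$. An object $E\in\mathrm{Mod}_{\mathrm{cart}}(R)$ is pure-injective if every pure-exact sequence $0\to E\to M\to N\to0$ in $\mathrm{Mod}_{\mathrm{cart}}(R)$ splits. A pure-injective envelope of $M$ is a morphism $\phi\colon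 M\to E$ with $E$ pure-injective such that every morphism $M\to E'$ with $E'$ pure-injective factors through $\phi$, and such that every endomorphism $f$ of $E$ with $f\circ\phi=\phi$ is an isomorphism. *)

(* Defs.v *)
From HB Require Import structures.
From mathcomp Require Import all_boot all_order all_algebra.
From mathcomp Require Import generic_quotient ring_quotient boolp freeg.

Set Implicit Arguments.
Unset Strict Implicit.
Unset Printing Implicit Defensive.

Import GRing.Theory.
Local Open Scope ring_scope.
Local Open Scope quotient_scope.

(* Rings are unitary and associative, not necessarily commutative, and the    *)
(* zero ring is allowed: this is pzRingType.  A left R-module is an           *)
(* lmodType R; a right R-module is a left module over the converse ring, i.e. *)
(* an lmodType R^c, where (a : R^c) *: m stands for m . a.                    *)

Definition conv_map (R S : pzRingType) (f : R -> S) : R^c -> S^c := f.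

Section ConvMap.
Context (R S : pzRingType) (f : {rmorphism R -> S}).

Fact conv_map_additive : zmod_morphism (conv_map f).
Proof. exact: (raddfB f). Qed.

Fact conv_map_multiplicative : monoid_morphism (conv_map f).
Proof. by split=> [|x y]; [exact: (rmorph1 f) | exact: (rmorphM f)]. Qed.

HB.instance Definition _ :=
  GRing.isZmodMorphism.Build R^c S^c (conv_map f) conv_map_additive.
HB.instance Definition _ :=
  GRing.isMonoidMorphism.Build R^c S^c (conv_map f) conv_map_multiplicative.

Definition conv : {rmorphism R^c -> S^c} := conv_map f.

End ConvMap.

Definition restrict (R S : pzRingType) (f : {rmorphism R -> S})
  (V : lmodType S) : Type := V.

Section Restrict.
Context (R S : pzRingType) (f : {rmorphism R -> S}) (V : lmodType S).

HB.instance Definition _ := GRing.Zmodule.on (restrict f V).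

Definition restrict_scale (a : R) (v : restrict f V) : restrict f V :=
  f a *: (v : V).

Fact restrict_scaleA a b v :
  restrict_scale a (restrict_scale b v) = restrict_scale (a * b) v.
Proof. by rewrite /restrict_scale scalerA rmorphM. Qed.

Fact restrict_scale1 : left_id 1 restrict_scale.
Proof. by move=> v; rewrite /restrict_scale rmorph1 scale1r. Qed.

Fact restrict_scaleDr : right_distributive restrict_scale +%R.
Proof. by move=> a u v; rewrite /restrict_scale (scalerDr (f a) (u : V)). Qed.

Fact restrict_scaleDl v : {morph restrict_scale^~ v : a b / a + b}.
Proof. by move=> a b; rewrite /restrict_scale rmorphD (scalerDl (v : V)). Qed.

HB.instance Definition _ := GRing.Zmodule_isLmodule.Build R (restrict f V)
  restrict_scaleA restrict_scale1 restrict_scaleDr restrict_scaleDl.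

End Restrict.

(* The tensor product of a right and a left R-module: the free abelian group  *)
(* on M * X modulo the subgroup generated by the usual relators.              *)
Section Tensor.
Context (R : pzRingType) (M : lmodType R^c) (X : lmodType R).

Local Notation free := {freeg (M * X)%type / int}.

Definition tensor_gen (m : M) (x : X) : free := [freeg [:: (1, (m, x))]].

Inductive tensor_relation : free -> Prop :=
| tensor_relation0 : tensor_relation 0
| tensor_relationB u v :
    tensor_relation u -> tensor_relation v -> tensor_relation (u - v)
| tensor_relationDl m m' x :
    tensor_relation (tensor_gen (m + m') x - tensor_gen m x - tensor_gen m' x)
| tensor_relationDr m x x' :
    tensor_relation (tensor_gen m (x + x') - tensor_gen m x - tensor_gen m x')
| tensor_relationZ (a : R) m x :
    tensor_relation (tensor_gen ((a : R^c) *: m) x - tensor_gen m (a *: x)).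

Definition tensor_ker (u : free) : bool := `[< tensor_relation u >].

Fact tensor_ker_closed : zmod_closed tensor_ker.
Proof.
split; first exact/asboolP/tensor_relation0.
by move=> u v /asboolP hu /asboolP hv; apply/asboolP/tensor_relationB.
Qed.

HB.instance Definition _ :=
  GRing.isZmodClosed.Build free tensor_ker tensor_ker_closed.

Local Notation quot :=
  (Quotient.quot (GRing.ZmodClosed.clone free tensor_ker _)).

Definition tensor : Type := quot.

HB.instance Definition _ := GRing.Zmodule.on tensor.

Definition tmul (m : M) (x : X) : tensor :=
  \pi_quot (tensor_gen m x).

Definition balanced (A : zmodType) (b : M -> X -> A) :=
  [/\ forall m m' x, b (m + m') x = b m x + b m' x,
      forall m x x', b m (x + x') = b m x + b m x'
    & forall (a : R) m x, b ((a : R^c) *: m) x = b m (a *: x)].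

(* The homomorphism m (x) x |-> b m x; meaningful for balanced b only. *)
Definition tensor_lift (A : zmodType) (b : M -> X -> A) (t : tensor) : A :=
  fglift (fun p : M * X => b p.1 p.2 : zmodule A)
    (repr (t : quot)).


Lemma tmulDl m m' x : tmul (m + m') x = tmul m x + tmul m' x.
Proof.
rewrite /tmul -raddfD; apply/eqP; rewrite -Quotient.idealrBE opprD addrA.
exact/asboolP/tensor_relationDl.
Qed.

Lemma tmulDr m x x' : tmul m (x + x') = tmul m x + tmul m x'.
Proof.
rewrite /tmul -raddfD; apply/eqP; rewrite -Quotient.idealrBE opprD addrA.
exact/asboolP/tensor_relationDr.
Qed.

Lemma tmulZ (a : R) m x : tmul ((a : R^c) *: m) x = tmul m (a *: x).
Proof.
rewrite /tmul; apply/eqP; rewrite -Quotient.idealrBE.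
exact/asboolP/tensor_relationZ.
Qed.

Lemma tmul_balanced : balanced tmul.
Proof. by split; [exact: tmulDl | exact: tmulDr | exact: tmulZ]. Qed.

Section Lift.
Context (A : zmodType) (b : M -> X -> A) (bal_b : balanced b).

Let free_lift : free -> zmodule A :=
  fglift (fun p : M * X => b p.1 p.2 : zmodule A).

Let free_liftB u v : free_lift (u - v) = free_lift u - free_lift v.
Proof. exact: lift_is_additive. Qed.

Let free_lift_gen m x : free_lift (tensor_gen m x) = b m x.
Proof. by rewrite /free_lift /tensor_gen liftU scale1r. Qed.

Let free_lift_relation u : tensor_relation u -> free_lift u = 0.
Proof.
have [bDl bDr bZ] := bal_b.
have lift0 : free_lift 0 = 0 by rewrite -(subrr 0) free_liftB subrr.
elim=> // *; rewrite !free_liftB ?free_lift_gen.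
- by apply/eqP; rewrite subr_eq0; apply/eqP; congruence.
- by rewrite bDl -addrA -opprD subrr.
- by rewrite bDr -addrA -opprD subrr.
- by rewrite bZ subrr.
Qed.

Let tensor_lift_pi u :
  tensor_lift b (\pi_quot u : tensor) = free_lift u.
Proof.
apply/eqP; rewrite -subr_eq0 -[X in X == _]free_liftB; apply/eqP.
by apply/free_lift_relation/asboolP; rewrite -/(tensor_ker _)
  [tensor_ker _]Quotient.idealrBE reprK.
Qed.

Lemma tensor_lift_tmul m x : tensor_lift b (tmul m x) = b m x.
Proof. by rewrite /tmul tensor_lift_pi free_lift_gen. Qed.

Lemma tensor_liftB : zmod_morphism (tensor_lift b).
Proof.
move=> t u; rewrite -[t](@reprK _ quot).
rewrite -[u](@reprK _ quot) -[_ - _]raddfB.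
by rewrite !tensor_lift_pi free_liftB.
Qed.

End Lift.

Lemma tensor_ind (P : tensor -> Prop) :
  (forall t u, P t -> P u -> P (t - u)) ->
  (forall m x, P (tmul m x)) -> forall t, P t.
Proof.
move=> PB Pgen t; rewrite -[t](@reprK _ quot).
have P0 : P 0 by rewrite -(subrr (tmul 0 0)); apply: PB.
have PN u : P u -> P (- u) by move=> Pu; rewrite -(sub0r u); apply: PB.
have PD u v : P u -> P v -> P (u + v).
  by move=> Pu Pv; rewrite -[v]opprK; apply/PB/PN.
pose pi : {additive free -> quot} := \pi_quot.
rewrite -[\pi_quot _]/(pi _) -[repr _]freeg_sumE raddf_sum.
apply: (big_ind P) => // -[m x] _; rewrite -[coeff _ _]intz -freegU_mulz.
rewrite raddfMz -[pi _]/(tmul m x : quot).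
have Pn n : P (tmul m x *+ n) by elim: n => // n Pn; rewrite mulrS; apply: PD.
by case: (coeff _ _) => n; [exact: Pn | exact/PN/Pn].
Qed.

End Tensor.

Section TensorMap.
Context (R : pzRingType) (M N : lmodType R^c) (f : {linear M -> N}).
Context (X : lmodType R).

Definition tensor_map : tensor M X -> tensor N X :=
  tensor_lift (fun m x => tmul (f m) x).

Fact tensor_map_balanced : balanced (fun (m : M) (x : X) => tmul (f m) x).
Proof.
by split=> *; rewrite ?linearD ?linearZ ?tmulDl ?tmulDr ?tmulZ.
Qed.

Lemma tensor_map_tmul m x : tensor_map (tmul m x) = tmul (f m) x.
Proof. exact: tensor_lift_tmul tensor_map_balanced m x. Qed.

HB.instance Definition _ :=
  GRing.isZmodMorphism.Build (tensor M X) (tensor N X) tensor_map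
    (tensor_liftB tensor_map_balanced).

End TensorMap.

Arguments tensor_map {R M N} f X.

(* For a ring morphism f : R -> S and a right R-module M, the right S-module  *)
(* M (x)_R S, where S is a left R-module through f.                           *)
Definition extend (R S : pzRingType) (f : {rmorphism R -> S})
  (M : lmodType R^c) : Type := tensor M (restrict f S^o).

Section Extend.
Context (R S : pzRingType) (f : {rmorphism R -> S}) (M : lmodType R^c).
Local Notation SR := (restrict f S^o).

HB.instance Definition _ := GRing.Zmodule.on (extend f M).

Definition extend_scale (a : S^c) (t : extend f M) : extend f M :=
  tensor_lift (fun (m : M) (x : SR) => tmul m ((x : S) * (a : S) : SR)) t.

Fact extend_scale_balanced (a : S) :
  balanced (fun (m : M) (x : SR) => tmul m ((x : S) * a : SR)).
Proof.
split=> [m m' x|m x x'|b m x]; first exact: tmulDl.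
  by rewrite -tmulDr; congr tmul; exact: (mulrDl (x : S) x' a).
by rewrite tmulZ; congr tmul; exact: (mulrA (f b) (x : S) a).
Qed.

Fact extend_scale_tmul (a : S) m (x : SR) :
  extend_scale a (tmul m x) = tmul m ((x : S) * a : SR).
Proof. exact: tensor_lift_tmul (extend_scale_balanced a) m x. Qed.

Fact extend_scaleB a : zmod_morphism (extend_scale a).
Proof. exact: tensor_liftB (extend_scale_balanced a). Qed.

Fact extend_scaleDr : right_distributive extend_scale +%R.
Proof.
move=> a t u; have scale0 : extend_scale a 0 = 0.
  by have := extend_scaleB a 0 0; rewrite !subrr.
by rewrite -{1}[u]opprK extend_scaleB -(sub0r u) extend_scaleB scale0 sub0r opprK.
Qed.

Fact extend_scaleA a b t :
  extend_scale a (extend_scale b t) = extend_scale (a * b) t.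
Proof.
elim/tensor_ind: t => [t u IHt IHu|m x]; first by rewrite !extend_scaleB IHt IHu.
by rewrite !extend_scale_tmul -mulrA.
Qed.

Fact extend_scale1 : left_id 1 extend_scale.
Proof.
elim/tensor_ind=> [t u IHt IHu|m x]; first by rewrite extend_scaleB IHt IHu.
by rewrite extend_scale_tmul mulr1.
Qed.

Fact extend_scaleDl t : {morph extend_scale^~ t : a b / a + b}.
Proof.
move=> a b; elim/tensor_ind: t => [t u IHt IHu|m x].
  by rewrite !extend_scaleB IHt IHu opprD addrACA.
by rewrite !extend_scale_tmul mulrDr tmulDr.
Qed.

HB.instance Definition _ := GRing.Zmodule_isLmodule.Build S^c (extend f M)
  extend_scaleA extend_scale1 extend_scaleDr extend_scaleDl.

Context (N : lmodType S^c) (h : {linear M -> restrict (conv f) N}).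

(* The adjoint of h : M -> f^* N, sending m (x) s to h(m) . s. *)
Definition adjoint : extend f M -> N :=
  tensor_lift (fun (m : M) (x : SR) => (x : S^c) *: (h m : N)).

Fact adjoint_balanced :
  balanced (fun (m : M) (x : SR) => (x : S^c) *: (h m : N)).
Proof.
split=> [m m' x|m x x'|a m x]; first by rewrite linearD (scalerDr _ (h m : N)).
  exact: (scalerDl (h m : N)).
by rewrite linearZ; exact: (scalerA _ _ (h m : N)).
Qed.

Lemma adjoint_tmul m (x : SR) : adjoint (tmul m x) = (x : S^c) *: (h m : N).
Proof. exact: tensor_lift_tmul adjoint_balanced m x. Qed.

Fact adjointB : zmod_morphism adjoint.
Proof. exact: tensor_liftB adjoint_balanced. Qed.

HB.instance Definition _ :=
  GRing.isZmodMorphism.Build (extend f M) N adjoint adjointB.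

Fact adjoint_scalable : scalable adjoint.
Proof.
move=> a t; rewrite -[LHS]/(adjoint (extend_scale a t)) -[RHS]/(a *: adjoint t).
elim/tensor_ind: t => [t u IHt IHu|m x].
  by rewrite extend_scaleB !adjointB IHt IHu scalerBr.
by rewrite extend_scale_tmul !adjoint_tmul scalerA.
Qed.

HB.instance Definition _ :=
  GRing.isScalable.Build S^c (extend f M) N *:%R adjoint adjoint_scalable.

End Extend.

(* 0 -> A -> B -> C -> 0 *)
Definition short_exact (A B C : zmodType) (f : A -> B) (g : B -> C) :=
  [/\ injective f, forall y, g y = 0 <-> exists x, f x = y
    & forall z, exists y, g y = z].

Definition pure_exact (R : pzRingType) (N M L : lmodType R^c)
    (f : {linear N -> M}) (g : {linear M -> L}) :=
  short_exact f g /\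
  forall X : lmodType R, short_exact (tensor_map f X) (tensor_map g X).

(* Smallness: the universe annotations put objects and arrows in the universe *)
(* of the carriers of modules.                                                *)
Record category := Category {
  ob : Type@{GRing.Lmodule.axioms_.u0};
  hom : ob -> ob -> Type@{GRing.Lmodule.axioms_.u0};
  idc : forall c, hom c c;
  compc : forall a b c, hom b c -> hom a b -> hom a c;
  compc1 : forall a b (f : hom a b), compc f (idc a) = f;
  comp1c : forall a b (f : hom a b), compc (idc b) f = f;
  compcA : forall a b c d (f : hom c d) (g : hom b c) (h : hom a b),
    compc f (compc g h) = compc (compc f g) h
}.

Record representation (C : category) := Representation {
  rep_ob :> ob C -> pzRingType;
  rep_map : forall c d, hom c d -> {rmorphism rep_ob c -> rep_ob d};
  rep_map1 : forall c (x : rep_ob c), rep_map (idc c) x = x;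
  rep_map_comp : forall a b c (f : hom b c) (g : hom a b) (x : rep_ob a),
    rep_map (compc f g) x = rep_map f (rep_map g x)
}.

Section Modules.
Context (C : category) (R : representation C).

Record rep_module := RepModule {
  mod_ob :> forall c : ob C, lmodType (R c)^c;
  mod_map : forall c d (a : hom c d),
    {linear mod_ob c -> restrict (conv (rep_map R a)) (mod_ob d)};
  mod_map1 : forall c (x : mod_ob c), mod_map (idc c) x = x :> mod_ob c;
  mod_map_comp : forall c d e (b : hom d e) (a : hom c d) (x : mod_ob c),
    mod_map (compc b a) x = mod_map b (mod_map a x) :> mod_ob e
}.

(* The adjoint is a linear map, so it is an isomorphism iff it is bijective.  *)
Definition cartesian (M : rep_module) :=
  forall c d (a : hom c d), bijective (adjoint (mod_map M a)).

Record cart_module := CartModule {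
  cart_val :> rep_module;
  cartP : cartesian cart_val
}.

Record morphism (M N : rep_module) := Morphism {
  mor_fun :> forall c, {linear M c -> N c};
  mor_nat : forall c d (a : hom c d) (x : M c),
    mor_fun d (mod_map M a x) = mod_map N a (mor_fun c x) :> N d
}.

Definition mor_eq (M N : rep_module) (f g : morphism M N) :=
  forall c, f c =1 g c.

Definition mor_id (M : rep_module) : morphism M M :=
  @Morphism M M (fun c => idfun) (fun _ _ _ _ => erefl).

Fact mor_comp_nat (M N L : rep_module) (g : morphism N L) (f : morphism M N)
    c d (a : hom c d) (x : M c) :
  (g d \o f d) (mod_map M a x) = mod_map L a ((g c \o f c) x) :> L d.
Proof. by rewrite /= mor_nat mor_nat. Qed.

Definition mor_comp (M N L : rep_module) (g : morphism N L)
    (f : morphism M N) : morphism M L :=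
  @Morphism M L (fun c => g c \o f c) (mor_comp_nat g f).

Definition isomorphism (M N : rep_module) (f : morphism M N) :=
  exists g : morphism N M,
    mor_eq (mor_comp g f) (mor_id M) /\ mor_eq (mor_comp f g) (mor_id N).

(* Objectwise exactness already makes f a kernel of g and g a cokernel of f   *)
(* in the full subcategory of cartesian modules.                              *)
Definition cart_pure_exact (N M L : cart_module)
    (f : morphism N M) (g : morphism M L) :=
  forall c, pure_exact (f c) (g c).

(* 0 -> N -> M -> L -> 0 splits when f : N -> M has a retraction. *)
Definition splits (N M L : cart_module) (f : morphism N M)
    (g : morphism M L) :=
  exists r : morphism M N, mor_eq (mor_comp r f) (mor_id N).

Definition pure_injective (E : cart_module) :=
  forall (M N : cart_module) (f : morphism E M) (g : morphism M N),
    cart_pure_exact f g -> splits f g.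

Definition pure_injective_envelope (M E : cart_module) (phi : morphism M E) :=
  [/\ pure_injective E,
      forall (E' : cart_module) (psi : morphism M E'), pure_injective E' ->
        exists g : morphism E E', mor_eq (mor_comp g phi) psi
    & forall f : morphism E E,
        mor_eq (mor_comp f phi) phi -> isomorphism f].

End Modules.

(* Main.v *)
Require Import Defs.
From HB Require Import structures.
From mathcomp Require Import all_boot all_order all_algebra.
From mathcomp Require Import generic_quotient ring_quotient boolp freeg.
From mathcomp Require Import classical_sets.
Import Defs.

(** Why pure-injective envelopes exist.

    Write T for Q/Z, an injective cogenerator of abelian groups.  For left
    modules A_c over the rings R_c, a pairing of N with A is a family of
    homomorphisms from the tensor product of N_c and A_c to T, c ranging over
    the objects.  A pure monomorphism from N to L makes the tensor product of
    N_c and A_c a subgroup of that of L_c and A_c, so by injectivity of T every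
    pairing of N extends to L.  Suppose that N |-> pairings of N is represented
    by a cartesian module E, that is, that every pairing of every N is the
    pullback of one pairing u of E along exactly one morphism from N to E.
    Then morphisms into E extend along pure monomorphisms, and E and all its
    retracts are pure-injective ([terminal_extension],
    [terminal_retract_pure_injective]).

    Such an E always exists ([terminal_exists], [terminal_unique]).  Two
    elements of a cartesian module N lie in a cartesian submodule that is the
    image of a family of terms depending on C and R only ([closure]); hence
    there is a set of modules of this kind up to isomorphism, and of pairings
    on them.  Take the direct sum B of all of them, with its obvious pairing,
    and divide it by the largest submodule that pairs to 0 and whose quotient
    is still cartesian.  Maps from the small submodules of N to the quotient
    agree on overlaps, because the difference of two maps with equal pairings
    has its image in what was divided out; so they glue to a map from N.

    For A_c the group of characters of M_c, evaluation is a pairing of M.  The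
    morphism j from M to E that classifies it is pure: every character of the
    tensor product of M_c with X factors through that of E_c with X
    ([embed_pure]).  So M is a pure submodule of a pure-injective module, and
    every pure-injective module is a retract of one of the form E, whence the
    extension property of all pure-injective modules
    ([pure_injective_extension]).

    It remains to make E small enough.  The endomorphisms of E correspond to
    the characters of the tensor products of E_c and A_c, and a space of
    characters is compact in an algebraic sense: call a set of endomorphisms
    closed when it consists of all endomorphisms that agree with it wherever
    its members agree with each other.  Injectivity of T shows that chains of
    closed sets have closed, nonempty intersections and that right
    multiplication maps closed sets to closed sets.  The argument of Ellis and
    Numakura in the closed monoid S of all f with f j = j then yields an
    idempotent e in a minimal left ideal of S ([minimal_idempotent]), so that
    each f in S has some g in S with g f e = e.  The image of e is the
    envelope: an endomorphism of it that is the identity on M has a left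
    inverse that is the identity on M, and a monoid in which all elements have
    left inverses is a group. *)

Set Implicit Arguments.
Unset Strict Implicit.
Unset Printing Implicit Defensive.

Import GRing.Theory Num.Theory.
Local Open Scope ring_scope.
Local Open Scope quotient_scope.

(** * The injective cogenerator Q/Z *)

Definition integral (q : rat) : bool := q \is a Num.int.

Fact integral_zmod_closed : zmod_closed integral.
Proof. by split=> [|p q]; [apply: rpred0 | apply: rpredB]. Qed.

HB.instance Definition _ :=
  GRing.isZmodClosed.Build rat integral integral_zmod_closed.

Local Notation integers := (GRing.ZmodClosed.clone rat integral _).

Definition QmodZ : zmodType := Quotient.quot integers.

Definition QmodZ_pi : {additive rat -> QmodZ} := \pi_(Quotient.quot integers).

Lemma QmodZ_pi_eq0 q : (QmodZ_pi q == 0) = (q \is a Num.int).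
Proof.
by rewrite -(raddf0 QmodZ_pi) -[q in RHS]subr0 [RHS](@Quotient.idealrBE _ integers).
Qed.

Lemma QmodZ_pi_surj t : exists q, QmodZ_pi q = t.
Proof. by exists (repr (t : Quotient.quot _)); apply: reprK. Qed.

Lemma QmodZ_divisible (t : QmodZ) n : exists t', t' *+ n.+1 = t.
Proof.
have [q <-] := QmodZ_pi_surj t; exists (QmodZ_pi (q / n.+1%:R)).
by rewrite -raddfMn -[_ *+ n.+1](mulr_natr (_ / _)) divfK // pnatr_eq0.
Qed.

Lemma QmodZ_torsion n : exists2 t : QmodZ, t != 0 & t *+ n.+2 = 0.
Proof.
exists (QmodZ_pi n.+2%:R^-1).
  rewrite QmodZ_pi_eq0; apply/negP => /intrP[m Em].
  have m1 : (m%:~R * n.+2%:R : rat) = 1 by rewrite -Em mulVf // pnatr_eq0.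
  have /(congr1 absz) : (m * n.+2 = 1)%R.
    by apply/(@intr_inj rat); rewrite intrM.
  by rewrite abszM /= => /eqP; rewrite muln_eq1 andbF.
rewrite -raddfMn -[_ *+ n.+2](mulr_natr _^-1) mulVf ?pnatr_eq0 //.
by apply/eqP; rewrite QmodZ_pi_eq0.
Qed.

Section PartialHom.
Variable G : zmodType.

(** Homomorphisms into Q/Z defined on a subgroup, given by their graphs: unions
    of chains and sums of two of them then need no choice of values. *)
Record partial_hom (D : G -> QmodZ -> Prop) : Prop := PartialHom {
  phom0 : D 0 0;
  phomB : forall x y s t, D x s -> D y t -> D (x - y) (s - t);
  phom_fun : forall t, D 0 t -> t = 0
}.

Lemma phom_unique D x s t : partial_hom D -> D x s -> D x t -> s = t.
Proof.
move=> hD Ds Dt; apply/subr0_eq/(phom_fun hD).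
by rewrite -(subrr x); apply: phomB.
Qed.

Lemma phomN D x s : partial_hom D -> D x s -> D (- x) (- s).
Proof. by move=> hD Ds; have := phomB hD (phom0 hD) Ds; rewrite !sub0r. Qed.

Lemma phomD D x y s t : partial_hom D -> D x s -> D y t -> D (x + y) (s + t).
Proof.
move=> hD Ds Dt; rewrite -[y]opprK -[t]opprK.
exact: phomB (phomN hD Dt).
Qed.

Lemma phomMn D x s n : partial_hom D -> D x s -> D (x *+ n) (s *+ n).
Proof.
move=> hD Ds; elim: n => [|n IH]; first exact: phom0.
by rewrite !mulrS; apply: phomD.
Qed.

(** Case d = 0: no positive multiple of x lies in K. *)
Lemma subgroup_multiples (K : G -> Prop) x :
    K 0 -> (forall y z, K y -> K z -> K (y - z)) ->
  exists d, forall n, K (x *+ n) <-> (d %| n)%N.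
Proof.
move=> K0 KB.
have KMn y n : K y -> K (y *+ n).
  have KN z : K z -> K (- z) by move=> Kz; rewrite -sub0r; apply: KB.
  move=> Ky; elim: n => // n IH; rewrite mulrS -[X in _ + X]opprK.
  exact/KB/KN.
case: (pselect (exists k, K (x *+ k.+1))) => [ex|nex]; last first.
  exists 0 => n; rewrite dvd0n; split=> [|/eqP->] //.
  by case: n => // n Kn; case: nex; exists n.
have exb : exists k, `[< K (x *+ k.+1) >].
  by case: ex => k Kk; exists k; apply/asboolP.
case: (ex_minnP exb) => k /asboolP Kk kmin; exists k.+1 => n; split=> [Kn|]; last first.
  by case/dvdnP=> q ->; rewrite mulnC mulrnA; apply: KMn.
rewrite /dvdn; case Er: (n %% k.+1)%N => [//|r].
have ltrk : (r.+1 < k.+1)%N by rewrite -Er ltn_pmod.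
suff Kr : K (x *+ r.+1).
  by have := kmin r; rewrite leqNgt -ltnS ltrk => /(_ (asboolT Kr)).
rewrite (_ : x *+ r.+1 = x *+ n - x *+ k.+1 *+ (n %/ k.+1)); last first.
  by rewrite {1}(divn_eq n k.+1) Er mulrnDr mulnC mulrnA addrAC subrr add0r.
by apply: KB => //; apply: KMn.
Qed.

Definition adjoin_value (D : G -> QmodZ -> Prop) (x : G) (t : QmodZ) :=
  fun y s => exists (n : int) y' s',
    [/\ D y' s', y = y' + x *~ n & s = s' + t *~ n].

(** The subgroup of all n with n x in the domain of D is the only obstruction
    to giving x the value t. *)
Lemma partial_hom_adjoin D x t : partial_hom D ->
  (forall n s, D (x *+ n) s -> s = t *+ n) -> partial_hom (adjoin_value D x t).
Proof.
move=> hD ht.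
have htz (n : int) s : D (x *~ n) s -> s = t *~ n.
  case: n => n; first exact: ht.
  by move=> /(phomN hD); rewrite NegzE !mulrNz opprK => /ht Es; rewrite -[s]opprK Es.
split.
- by exists 0, 0, 0; rewrite !mulr0z !addr0; split=> //; apply: phom0.
- move=> y z r s [n [y' [r' [Dy -> ->]]]] [m [z' [s' [Dz -> ->]]]].
  exists (n - m), (y' - z'), (r' - s'); split; first exact: phomB.
    by rewrite mulrzBr opprD addrACA.
  by rewrite mulrzBr opprD addrACA.
- move=> s [n [y' [s' [Dy /esym/eqP]]]]; rewrite addrC addr_eq0 => /eqP Ey ->.
  by rewrite -(htz n (- s')) ?subrr // Ey; apply: phomN.
Qed.

Lemma partial_hom_sub D x t y s : D y s -> adjoin_value D x t y s.
Proof. by move=> Dy; exists 0, y, s; rewrite !mulr0z !addr0. Qed.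

Lemma partial_hom_adjoined D x t : partial_hom D -> adjoin_value D x t x t.
Proof. by move=> hD; exists 1, 0, 0; rewrite !add0r; split=> //; apply: phom0. Qed.

(** If d generates the subgroup of all n with n x in the domain of D, a value t
    for x is admissible as soon as d t is the value of D at d x; divisibility
    provides such a t. *)
Lemma partial_hom_extend D x : partial_hom D ->
  exists t, partial_hom (adjoin_value D x t).
Proof.
move=> hD; pose K y := exists s, D y s.
have [d hd] : exists d, forall n, K (x *+ n) <-> (d %| n)%N.
  apply: subgroup_multiples; first by exists 0; apply: phom0.
  by move=> y z [s Ds] [t Dt]; exists (s - t); apply: phomB.
suff [t ht] : exists t, forall s, D (x *+ d) s -> s = t *+ d.
  exists t; apply: partial_hom_adjoin => // n s Dn.
  have /dvdnP[q Eq] : (d %| n)%N by apply/hd; exists s.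
  have [r Dr] : K (x *+ d) by apply/hd.
  apply: (phom_unique hD Dn); rewrite Eq mulnC !mulrnA -(ht _ Dr).
  exact: phomMn.
case: d hd => [_|d hd]; first by exists 0 => s; rewrite !mulr0n; apply: phom_fun.
have [r Dr] : K (x *+ d.+1) by apply/hd.
have [t Et] := QmodZ_divisible r d; exists t => s Ds.
by rewrite Et (phom_unique hD Ds Dr).
Qed.

(** By Zorn's lemma the graph D lies in a maximal one, which is total because
    any further element can be given a value. *)
Theorem QmodZ_injective D : partial_hom D ->
  exists h : {additive G -> QmodZ}, forall x t, D x t -> h x = t.
Proof.
move=> hD.
pose P (X : set (G * QmodZ)) := partial_hom (fun x t => D x t \/ X (x, t)).
have [X [hX maxX]] : exists X, P X /\ forall Y, (X `<` Y)%classic -> ~ P Y.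
  apply: Zorn_bigcup => F FP Ftot.
  have up x y s t :
      D x s \/ (\bigcup_(X in F) X)%classic (x, s) ->
      D y t \/ (\bigcup_(X in F) X)%classic (y, t) ->
    (D x s /\ D y t) \/ exists2 X, F X & (D x s \/ X (x, s)) /\ (D y t \/ X (y, t)).
    case=> [Dx|[X FX Xx]] [Dy|[Y FY Yy]].
    - by left.
    - by right; exists Y => //; split; [left|right].
    - by right; exists X => //; split; [right|left].
    - case: (Ftot X Y FX FY) => le.
        by right; exists Y => //; split; right=> //; apply: le.
      by right; exists X => //; split; right=> //; apply: le.
  split.
  - by left; apply: phom0.
  - move=> x y s t Dx Dy; case: (up _ _ _ _ Dx Dy) => [[{}Dx {}Dy]|].
      by left; apply: phomB.
    move=> [X FX [{}Dx {}Dy]]; case: (phomB (FP _ FX) Dx Dy); first by left.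
    by right; exists X.
  - move=> t [Dt|[X FX Xt]]; first exact: (phom_fun hD).
    by apply: (phom_fun (FP _ FX)); right.
pose D' x t := D x t \/ X (x, t); have {}hX : partial_hom D' := hX.
have total x : exists t, D' x t.
  have [t ht] := partial_hom_extend x hX.
  pose Y : set (G * QmodZ) := fun p => adjoin_value D' x t p.1 p.2.
  have D'Y y s : D' y s -> Y (y, s).
    exact: partial_hom_sub.
  have PY : P Y.
    rewrite /P (_ : (fun _ _ => _) = adjoin_value D' x t) //.
    apply/funext => y; apply/funext => s; apply/propext; split; last by right.
    by case=> // Dy; apply: D'Y; left.
  exists t; apply: contrapT => nD; apply: maxX PY; split.
    by move=> [y s] Xys; apply: D'Y; right.
  move=> /(_ (x, t)) YX; apply: nD; right; apply: YX.
  exact: partial_hom_adjoined.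
have [h Dh] := choice total.
have hB : zmod_morphism h.
  by move=> x y; apply: (phom_unique hX (Dh _)); apply: phomB.
pose hm := GRing.isZmodMorphism.Build G QmodZ h hB.
pose ha : {additive G -> QmodZ} := HB.pack h hm.
by exists ha => x t Dx; apply: (phom_unique hX (Dh x)); left.
Qed.

(** Modulo K the element x has an order d, possibly infinite, and Q/Z contains a
    nonzero element killed by d that can serve as the value of x. *)
Lemma QmodZ_separates (K : G -> Prop) x :
    K 0 -> (forall y z, K y -> K z -> K (y - z)) -> ~ K x ->
  exists h : {additive G -> QmodZ}, (forall y, K y -> h y = 0) /\ h x != 0.
Proof.
move=> K0 KB nKx.
pose D (y : G) (s : QmodZ) := K y /\ s = 0.
have hD : partial_hom D.
  split=> [//|y z _ _ [Ky ->] [Kz ->]|t [_]] //.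
  by split; [apply: KB | rewrite subrr].
have [d hd] := subgroup_multiples x K0 KB.
have [t t0 td] : exists2 t : QmodZ, t != 0 & t *+ d = 0.
  case: d hd => [|[|d]] hd; last exact: QmodZ_torsion.
    by have [t t0 _] := QmodZ_torsion 0; exists t.
  by case: nKx; rewrite -[x]mulr1n; apply/hd.
have hDx : partial_hom (adjoin_value D x t).
  apply: partial_hom_adjoin => // n _ [/hd/dvdnP[q ->] ->].
  by rewrite mulnC mulrnA td mul0rn.
have [h hh] := QmodZ_injective hDx; exists h; split.
  by move=> y Ky; apply: hh; apply: partial_hom_sub.
by rewrite (hh x t) //; apply: partial_hom_adjoined.
Qed.

End PartialHom.

(** * Tensor products *)

Section TensorFacts.
Variables (R : pzRingType) (M : lmodType R^c) (X : lmodType R).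

Lemma tmul0l (x : X) : tmul (0 : M) x = 0.
Proof. by apply: (addrI (tmul 0 x)); rewrite -tmulDl !addr0. Qed.

Lemma tmulNl (m : M) (x : X) : tmul (- m) x = - tmul m x.
Proof. by apply/eqP; rewrite -addr_eq0 -tmulDl addNr tmul0l. Qed.

Lemma tmulBl (m m' : M) (x : X) : tmul (m - m') x = tmul m x - tmul m' x.
Proof. by rewrite tmulDl tmulNl. Qed.

Lemma tmul_suml (I : Type) (s : seq I) (F : I -> M) (x : X) :
  tmul (\sum_(i <- s) F i) x = \sum_(i <- s) tmul (F i) x.
Proof.
elim: s => [|i s IH]; first by rewrite !big_nil tmul0l.
by rewrite !big_cons tmulDl IH.
Qed.

Lemma tensor_sum (t : tensor M X) :
  exists s : seq (M * X), t = \sum_(p <- s) tmul p.1 p.2.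
Proof.
elim/tensor_ind: t => [_ _ [s ->] [s' ->]|m x]; last first.
  by exists [:: (m, x)]; rewrite big_seq1.
exists (s ++ [seq (- p.1, p.2) | p <- s']); rewrite big_cat big_map -sumrN.
by congr (_ + _); apply: eq_bigr => p _; rewrite tmulNl.
Qed.

Lemma tensor_additive_eq (A : zmodType) (f g : {additive tensor M X -> A}) :
  (forall m x, f (tmul m x) = g (tmul m x)) -> f =1 g.
Proof.
by move=> fg; elim/tensor_ind=> [t u|m x] //; rewrite !raddfB => -> ->.
Qed.

Section TensorHom.
Variables (A : zmodType) (b : M -> X -> A) (bal_b : balanced b).
HB.instance Definition _ := GRing.isZmodMorphism.Build (tensor M X) A
  (tensor_lift b) (tensor_liftB bal_b).
Definition tensor_hom : {additive tensor M X -> A} := tensor_lift b.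
Lemma tensor_hom_tmul m x : tensor_hom (tmul m x) = b m x.
Proof. exact: tensor_lift_tmul. Qed.
End TensorHom.

Lemma balanced0l (A : zmodType) (b : M -> X -> A) x : balanced b -> b 0 x = 0.
Proof. by case=> bD _ _; apply: (addrI (b 0 x)); rewrite -bD !addr0. Qed.

Lemma balancedBl (A : zmodType) (b : M -> X -> A) m m' x : balanced b ->
  b (m - m') x = b m x - b m' x.
Proof.
move=> hb; have [bD _ _] := hb; rewrite bD; congr (_ + _); apply/eqP.
by rewrite -addr_eq0 -bD addNr (balanced0l _ hb).
Qed.

End TensorFacts.

Section TensorMapFacts.
Variables (R : pzRingType) (X : lmodType R).

Lemma tensor_mapB (M N : lmodType R^c) (f : {linear M -> N}) t u :
  tensor_map f X (t - u) = tensor_map f X t - tensor_map f X u.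
Proof. exact: raddfB. Qed.

Lemma tensor_map0 (M N : lmodType R^c) (f : {linear M -> N}) :
  tensor_map f X 0 = 0.
Proof. exact: raddf0. Qed.

Lemma tensor_map_sum (M N : lmodType R^c) (f : {linear M -> N}) (I : Type)
    (s : seq I) (F : I -> tensor M X) :
  tensor_map f X (\sum_(i <- s) F i) = \sum_(i <- s) tensor_map f X (F i).
Proof. exact: raddf_sum. Qed.

Lemma tensor_map_comp (M N L : lmodType R^c) (g : {linear N -> L})
    (f : {linear M -> N}) (h : {linear M -> L}) : (forall x, h x = g (f x)) ->
  forall t, tensor_map g X (tensor_map f X t) = tensor_map h X t.
Proof.
move=> hE; elim/tensor_ind=> [t u IHt IHu|m x].
  by rewrite !tensor_mapB IHt IHu.
by rewrite !tensor_map_tmul hE.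
Qed.

Lemma tensor_map_id (M : lmodType R^c) (f : {linear M -> M}) :
  (forall x, f x = x) -> forall t, tensor_map f X t = t.
Proof.
move=> fE; elim/tensor_ind=> [t u IHt IHu|m x].
  by rewrite !tensor_mapB IHt IHu.
by rewrite !tensor_map_tmul fE.
Qed.

Lemma tensor_map_surj (M N : lmodType R^c) (f : {linear M -> N}) :
  (forall y, exists x, f x = y) -> forall t, exists s, tensor_map f X s = t.
Proof.
move=> fsurj; elim/tensor_ind=> [_ _ [t <-] [u <-]|n x].
  by exists (t - u); rewrite tensor_mapB.
by have [m <-] := fsurj n; exists (tmul m x); rewrite tensor_map_tmul.
Qed.

(** Right exactness in the middle.  A character that vanishes on the image of
    f (x) X and not at t would induce a balanced map on L and X, hence factor
    through g (x) X, which kills t. *)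
Lemma tensor_map_exact (N M L : lmodType R^c) (f : {linear N -> M})
    (g : {linear M -> L}) :
    (forall y, g y = 0 <-> exists x, f x = y) -> (forall z, exists y, g y = z) ->
  forall t, tensor_map g X t = 0 <-> exists s, tensor_map f X s = t.
Proof.
move=> ex gsurj t; split=> [gt0|[s <-]]; last first.
  elim/tensor_ind: s => [t' u' IHt IHu|m x].
    by rewrite !tensor_mapB IHt IHu subrr.
  rewrite !tensor_map_tmul (_ : g (f m) = 0) ?tmul0l //.
  by apply/ex; exists m.
apply: contrapT => nt.
pose K t := exists s, tensor_map f X s = t.
have [||chi [chi0 /eqP chit]] := @QmodZ_separates _ K t _ _ nt.
- by exists 0; rewrite tensor_map0.
- by move=> _ _ [s <-] [s' <-]; exists (s - s'); rewrite tensor_mapB.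
(* Set-theoretic section of g; chi only sees it modulo the image of f. *)
have [sec gK] := choice gsurj.
have bE y z x : g y = g z -> chi (tmul y x) = chi (tmul z x).
  move=> gyz; apply/eqP; rewrite -subr_eq0 -raddfB -tmulBl; apply/eqP.
  have [n <-] : exists n, f n = y - z by apply/ex; rewrite linearB gyz subrr.
  by apply: chi0; exists (tmul n x); rewrite tensor_map_tmul.
pose b (l : L) (x : X) := chi (tmul (sec l) x).
have bal_b : balanced b.
  split=> [l l' x|l x x'|a l x]; rewrite /b.
  - by rewrite -raddfD -tmulDl; apply: bE; rewrite linearD !gK.
  - by rewrite tmulDr raddfD.
  - by rewrite -tmulZ; apply: bE; rewrite linearZ /= !gK.
apply: chit; have <- : tensor_hom bal_b (tensor_map g X t) = chi t.
  elim/tensor_ind: {gt0 nt} t => [t u IHt IHu|m x].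
    by rewrite tensor_mapB !raddfB /= IHt IHu.
  by rewrite tensor_map_tmul tensor_hom_tmul; apply: bE; rewrite gK.
by rewrite gt0 raddf0.
Qed.

End TensorMapFacts.

(** * Submodules and quotients of a module *)

Record submod (R : pzRingType) (V : lmodType R) := Submod {
  sm_mem :> V -> Prop;
  sm0 : sm_mem 0;
  smZD : forall a x y, sm_mem x -> sm_mem y -> sm_mem (a *: x + y)
}.

Section Submod.
Variables (R : pzRingType) (V : lmodType R) (P : submod V).

Lemma smD x y : P x -> P y -> P (x + y).
Proof. by move=> Px Py; rewrite -[x]scale1r; apply: smZD. Qed.

Lemma smZ a x : P x -> P (a *: x).
Proof. by move=> Px; rewrite -[_ *: _]addr0; apply/smZD/sm0. Qed.

Definition submod_pred : pred V := fun x => `[< P x >].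

Fact submod_pred_closed : submod_closed submod_pred.
Proof.
split; first exact/asboolP/sm0.
by move=> a u v /asboolP Pu /asboolP Pv; apply/asboolP/smZD.
Qed.

HB.instance Definition _ :=
  GRing.isSubmodClosed.Build R V submod_pred submod_pred_closed.
End Submod.

Definition linear_of (R : pzRingType) (U V : lmodType R) (f : U -> V)
    (lin_f : linear f) : {linear U -> V} :=
  HB.pack f (GRing.isLinear.Build R U V *:%R f lin_f).

Section SubQuotient.
Variables (R : pzRingType) (V : lmodType R) (P : submod V).

Definition sub_of : Type := {x : V | submod_pred P x}.
HB.instance Definition _ := SubChoice.on sub_of.
HB.instance Definition _ := GRing.SubChoice_isSubLmodule.Build R V
  (submod_pred P) sub_of (submod_pred_closed P).

Definition sub_incl : {linear sub_of -> V} := (\val : sub_of -> V).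

Lemma sub_inclP x : P (sub_incl x).
Proof. exact/asboolP/(valP x). Qed.

Lemma sub_incl_inj : injective sub_incl.
Proof. exact: val_inj. Qed.

Lemma sub_inclD x y : sub_incl (x + y) = sub_incl x + sub_incl y.
Proof. exact: raddfD. Qed.

Lemma sub_inclZ a x : sub_incl (a *: x) = a *: sub_incl x.
Proof. exact: linearZ. Qed.

Definition sub_mk x (Px : P x) : sub_of := exist _ x (asboolT Px).

Local Notation quotV :=
  (Quotient.quot (GRing.ZmodClosed.clone V (submod_pred P) _)).
Definition quot_of : Type := quotV.
HB.instance Definition _ := GRing.Zmodule.on quot_of.

Let pi : {additive V -> quot_of} := \pi_quotV.

Let pi_eq0 x : pi x = 0 <-> P x.
Proof.
have E : (pi x == 0) = submod_pred P x.
  by rewrite -(raddf0 pi) -[x in RHS]subr0 [RHS]Quotient.idealrBE.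
split=> [pix0|Px]; last by apply/eqP; rewrite E; apply/asboolP.
by apply/asboolP; rewrite -/(submod_pred P x) -E pix0.
Qed.

Let pi_repr q : pi (repr (q : quotV)) = q.
Proof. exact: reprK. Qed.

Let pi_eq x y : P (x - y) -> pi x = pi y.
Proof. by move/pi_eq0; rewrite raddfB => /subr0_eq. Qed.

Let pi_repr_sub x : P (repr (pi x : quotV) - x).
Proof. by apply/pi_eq0; rewrite raddfB /= pi_repr subrr. Qed.

Definition quot_scale (a : R) (q : quot_of) : quot_of :=
  \pi_quotV (a *: repr (q : quotV)).

Let scale_pi a x : quot_scale a (pi x) = pi (a *: x).
Proof. by apply: pi_eq; rewrite -scalerBr; apply/smZ/pi_repr_sub. Qed.

Fact quot_scaleA a b v : quot_scale a (quot_scale b v) = quot_scale (a * b) v.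
Proof. by rewrite -[v]pi_repr !scale_pi scalerA. Qed.

Fact quot_scale1 : left_id 1 quot_scale.
Proof. by move=> v; rewrite -[v]pi_repr scale_pi scale1r. Qed.

Fact quot_scaleDr : right_distributive quot_scale +%R.
Proof.
move=> a u v; rewrite -[u]pi_repr -[v]pi_repr -raddfD !scale_pi.
by rewrite scalerDr raddfD.
Qed.

Fact quot_scaleDl v : {morph quot_scale^~ v : a b / a + b}.
Proof. by move=> a b; rewrite -[v]pi_repr !scale_pi scalerDl raddfD. Qed.

HB.instance Definition _ := GRing.Zmodule_isLmodule.Build R quot_of
  quot_scaleA quot_scale1 quot_scaleDr quot_scaleDl.

Let pi_linear : linear (pi : V -> quot_of).
Proof. by move=> a x y; rewrite raddfD -scale_pi. Qed.

Definition quot_pi : {linear V -> quot_of} := linear_of pi_linear.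

Lemma quot_pi_eq0 x : quot_pi x = 0 <-> P x.
Proof. exact: pi_eq0. Qed.

Lemma quot_pi_surj q : exists x, quot_pi x = q.
Proof. by exists (repr (q : quotV)); apply: pi_repr. Qed.

End SubQuotient.

Section Corestrict.
Variables (R : pzRingType) (U V : lmodType R) (P : submod V).
Variables (f : {linear U -> V}) (fP : forall x, P (f x)).

Fact corestrict_linear : linear (fun x => sub_mk (fP x)).
Proof. by move=> a x y; apply: sub_incl_inj; rewrite [RHS]linearP; apply: linearP. Qed.

Definition corestrict : {linear U -> sub_of P} := linear_of corestrict_linear.

End Corestrict.

Section QuotLift.
Variables (R : pzRingType) (V W : lmodType R) (P : submod V).
Variables (f : {linear V -> W}) (fP : forall x, P x -> f x = 0).

Let lift (q : quot_of P) : W :=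
  f (repr (q : Quotient.quot (GRing.ZmodClosed.clone V (submod_pred P) _))).

Let lift_pi x : lift (quot_pi P x) = f x.
Proof.
apply/eqP; rewrite -subr_eq0 -linearB; apply/eqP/fP/quot_pi_eq0.
by rewrite linearB; apply/eqP; rewrite subr_eq0; apply/eqP; apply: reprK.
Qed.

Fact quot_lift_linear : linear lift.
Proof.
move=> a q r; have [x <-] := quot_pi_surj q; have [y <-] := quot_pi_surj r.
by rewrite -linearP !lift_pi linearP.
Qed.

Definition quot_lift : {linear quot_of P -> W} := linear_of quot_lift_linear.

Lemma quot_liftE x : quot_lift (quot_pi P x) = f x.
Proof. exact: lift_pi. Qed.

End QuotLift.

(** * Finite character of tensor relations *)

Section FreeLift.
Variables (T : choiceType) (A : zmodType) (b : T -> A).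

Definition free_lift (u : {freeg T / int}) : A :=
  fglift (b : T -> zmodule A) u.

Fact free_lift_additive : zmod_morphism free_lift.
Proof. exact: (@lift_is_additive int T (zmodule A) b). Qed.

HB.instance Definition _ := GRing.isZmodMorphism.Build {freeg T / int} A
  free_lift free_lift_additive.

Lemma free_lift_gen x : free_lift [freeg [:: (1, x)]] = b x.
Proof. by rewrite /free_lift liftU scale1r. Qed.

End FreeLift.

Section FiniteCharacter.
Variables (R : pzRingType) (N : lmodType R^c) (X : lmodType R).
Local Notation free := {freeg (N * X)%type / int}.

Section Retract.
Variable P : submod N.

Definition point_retract (x : N) : sub_of P := insubd (0 : sub_of P) x.

Lemma point_retractK x : P x -> sub_incl P (point_retract x) = x.
Proof. by move=> Px; rewrite /point_retract /sub_incl /= insubdK //; apply/asboolP. Qed.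

Definition free_retract : {additive free -> tensor (sub_of P) X} :=
  free_lift (fun p : N * X => tmul (point_retract p.1) p.2).

Lemma free_retract_gen x r :
  free_retract (tensor_gen x r) = tmul (point_retract x) r.
Proof. exact: free_lift_gen. Qed.

End Retract.

(** [free_retract] uses the map from N to P that is the identity on P and 0
    elsewhere.  It is not linear, but it respects each of the finitely many
    relators in a derivation of u once P contains the elements of N that occur
    in them. *)
Lemma tensor_relation_finite u : tensor_relation u ->
  exists w : seq N, forall P : submod N, (forall x, x \in w -> P x) ->
    free_retract P u = 0.
Proof.
elim=> {u} [|u v _ [w hw] _ [w' hw']|m m' x|m x x'|a m x].
- by exists [::] => P _; rewrite raddf0.
- exists (w ++ w') => P Pw; rewrite raddfB hw ?hw' ?subrr // => y yw;
    by apply: Pw; rewrite mem_cat yw ?orbT.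
- exists [:: m; m'] => P Pw.
  have Pm : P m by apply: Pw; rewrite inE eqxx.
  have Pm' : P m' by apply: Pw; rewrite !inE eqxx orbT.
  rewrite !raddfB /= !free_retract_gen (_ : point_retract P (m + m') =
    point_retract P m + point_retract P m').
    by rewrite tmulDl addrAC addrK subrr.
  by apply: sub_incl_inj; rewrite sub_inclD !point_retractK //; apply: smD.
- exists [::] => P _; rewrite !raddfB /= !free_retract_gen tmulDr.
  by rewrite addrAC addrK subrr.
- exists [:: m] => P Pw; have Pm : P m by apply: Pw; rewrite inE eqxx.
  rewrite raddfB /= !free_retract_gen -tmulZ.
  rewrite (_ : point_retract P ((a : R^c) *: m) = (a : R^c) *: point_retract P m).
    by rewrite subrr.
  by apply: sub_incl_inj; rewrite sub_inclZ !point_retractK //; apply: smZ.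
Qed.

(** Hence a relation in N (x) X already holds in P (x) X for each submodule P
    that contains finitely many suitable elements. *)
Lemma tensor_zero_finite (s : seq (N * X)) :
    \sum_(p <- s) tmul p.1 p.2 = 0 ->
  exists w : seq N, forall P : submod N, (forall x, x \in w -> P x) ->
    \sum_(p <- s) tmul (point_retract P p.1) p.2 = 0.
Proof.
move=> s0; pose u : free := \sum_(p <- s) tensor_gen p.1 p.2.
have /tensor_relation_finite[w hw] : tensor_relation u.
  pose quot := Quotient.quot (GRing.ZmodClosed.clone free (@tensor_ker R N X) _).
  pose pi : {additive free -> quot} := \pi_quot.
  apply/asboolP; rewrite -/(tensor_ker u) -[u]subr0.
  rewrite [tensor_ker _]Quotient.idealrBE; apply/eqP.
  by rewrite -[LHS]/(pi u) -[RHS]/(pi 0) raddf0 raddf_sum; apply: s0.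
exists w => P /hw Pu; transitivity (free_retract P u) => //; rewrite [RHS]raddf_sum.
by apply: eq_bigr => p _; rewrite [RHS]free_retract_gen.
Qed.

End FiniteCharacter.

(** * Cartesian modules *)

Lemma inj_surj_bij (A B : Type) (f : A -> B) :
  injective f -> (forall y, exists x, f x = y) -> bijective f.
Proof.
by move=> inj_f /choice[g gK]; exists g => // x; apply: inj_f; rewrite gK.
Qed.

Section RepModules.
Context (C : category) (R : representation C).

Local Notation scalars a := (restrict (rep_map R a) (R _)^o).

Definition push (N : rep_module R) c d (a : hom c d) (x : N c) (r : R d) : N d :=
  (r : (R d)^c) *: (mod_map N a x : N d).

Lemma push_balanced (N : rep_module R) c d (a : hom c d) :
  balanced (fun (x : N c) (r : scalars a) => push a x r).
Proof. exact: adjoint_balanced. Qed.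

(** The adjoint of the structure map of N at a, bundled as a homomorphism on
    the plain tensor product. *)
Definition adjoint_hom (N : rep_module R) c d (a : hom c d) :
    {additive tensor (N c) (scalars a) -> N d} :=
  tensor_hom (push_balanced N a).

Lemma adjoint_hom_tmul (N : rep_module R) c d (a : hom c d) (x : N c) (r : R d) :
  adjoint_hom N a (tmul x (r : scalars a)) = push a x r.
Proof. exact: tensor_hom_tmul. Qed.

Lemma adjoint_homB (N : rep_module R) c d (a : hom c d) t u :
  adjoint_hom N a (t - u) = adjoint_hom N a t - adjoint_hom N a u.
Proof. exact: raddfB. Qed.

(** Membership in the R_d-submodule of N_d generated by the image of P. *)
Definition spanned (N : rep_module R) c d (a : hom c d) (P : N c -> Prop) (y : N d) :=
  exists s : seq (N c * R d), (forall p, p \in s -> P p.1) /\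
    y = \sum_(p <- s) push a p.1 p.2.

Lemma spanned_adjoint_hom (N : rep_module R) c d (a : hom c d)
    (t : tensor (N c) (scalars a)) :
  spanned a (fun _ => True) (adjoint_hom N a t).
Proof.
have [s ->] := tensor_sum t; exists s; split=> //.
by rewrite raddf_sum; apply: eq_bigr => p _; apply: adjoint_hom_tmul.
Qed.

Lemma cartesian_spanned (N : cart_module R) c d (a : hom c d) (y : N d) :
  spanned a (fun _ => True) y.
Proof.
have [g _ gK] := cartP N a; rewrite -[y]gK; apply: spanned_adjoint_hom.
Qed.

Lemma cartesian_inj (N : cart_module R) c d (a : hom c d) : injective (adjoint_hom N a).
Proof. exact: bij_inj (cartP N a). Qed.

Lemma cartesianI (N : rep_module R) :
    (forall c d (a : hom c d) (y : N d), spanned a (fun _ => True) y) ->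
    (forall c d (a : hom c d) t, adjoint_hom N a t = 0 -> t = 0) -> cartesian N.
Proof.
move=> gen inj c d a; apply: inj_surj_bij.
  by apply: (@raddf_inj _ _ (adjoint_hom N a)) => t /inj.
move=> y; have [s [_ ->]] := gen c d a y.
exists (\sum_(p <- s) tmul p.1 (p.2 : scalars a)).
rewrite -[LHS]/(adjoint_hom N a _) raddf_sum.
by apply: eq_bigr => p _; apply: adjoint_hom_tmul.
Qed.

Lemma spanned_sub (N : rep_module R) c d (a : hom c d) (P Q : N c -> Prop) y :
  (forall x, P x -> Q x) -> spanned a P y -> spanned a Q y.
Proof. by move=> PQ [s [sP ->]]; exists s; split=> // p /sP /PQ. Qed.

Lemma spannedD (N : rep_module R) c d (a : hom c d) (P : N c -> Prop) y z :
  spanned a P y -> spanned a P z -> spanned a P (y + z).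
Proof.
move=> [s [sP ->]] [s' [sP' ->]]; exists (s ++ s'); rewrite big_cat; split=> // p.
by rewrite mem_cat => /orP[/sP|/sP'].
Qed.

Section Nat.
Variables (N L : rep_module R) (f : morphism N L).

Lemma push_nat c d (a : hom c d) x r : f d (push a x r) = push a (f c x) r.
Proof. by rewrite /push linearZ mor_nat. Qed.

Lemma adjoint_hom_nat c d (a : hom c d) t :
  adjoint_hom L a (tensor_map (f c) _ t) = f d (adjoint_hom N a t).
Proof.
elim/tensor_ind: t => [t u IHt IHu|x r].
  by rewrite tensor_mapB !adjoint_homB IHt IHu linearB.
by rewrite tensor_map_tmul !adjoint_hom_tmul push_nat.
Qed.

Lemma spanned_nat c d (a : hom c d) (P : N c -> Prop) (Q : L c -> Prop) y :
  (forall x, P x -> Q (f c x)) -> spanned a P y -> spanned a Q (f d y).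
Proof.
move=> PQ [s [sP ->]]; exists [seq (f c p.1, p.2) | p <- s]; split.
  by move=> _ /mapP[p /sP/PQ ? ->].
by rewrite big_map linear_sum; apply: eq_bigr => p _; rewrite push_nat.
Qed.

End Nat.

Record submodule (N : rep_module R) := Submodule {
  sub_at :> forall c, submod (N c);
  sub_map : forall c d (a : hom c d) x, sub_at c x -> sub_at d (mod_map N a x : N d)
}.

Section SubRep.
Variables (N : rep_module R) (P : submodule N).

Definition sub_rep_map c d (a : hom c d) (x : sub_of (P c)) :
    restrict (conv (rep_map R a)) (sub_of (P d)) :=
  sub_mk (sub_map a (sub_inclP x)).

Fact sub_rep_map_linear c d (a : hom c d) : linear (@sub_rep_map c d a).
Proof.
move=> r x y; apply: sub_incl_inj.
exact: (linearP (mod_map N a) r (sub_incl _ x) (sub_incl _ y)).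
Qed.

Definition sub_rep : rep_module R.
Proof.
refine (@RepModule _ _ (fun c => sub_of (P c))
  (fun c d a => linear_of (@sub_rep_map_linear c d a)) _ _).
- by move=> c x; apply: sub_incl_inj; apply: mod_map1.
- by move=> c d e b a x; apply: sub_incl_inj; apply: mod_map_comp.
Defined.

Definition sub_rep_incl : morphism sub_rep N :=
  @Morphism _ _ sub_rep N (fun c => sub_incl (P c)) (fun _ _ _ _ => erefl).

End SubRep.

Section Corestriction.
Variables (L N : rep_module R) (f : morphism L N) (P : submodule N).
Hypothesis fP : forall c x, P c (f c x).

Definition sub_rep_corestrict : morphism L (sub_rep P).
Proof.
refine (@Morphism _ _ L (sub_rep P) (fun c => corestrict (@fP c)) _).
by move=> c d a x; apply: sub_incl_inj; apply: mor_nat.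
Defined.

End Corestriction.

Section QuotRep.
Variables (N : rep_module R) (P : submodule N).

Definition quot_rep_fun c d (a : hom c d) (x : N c) :
    restrict (conv (rep_map R a)) (quot_of (P d)) :=
  quot_pi (P d) (mod_map N a x).

Fact quot_rep_fun_linear c d (a : hom c d) : linear (@quot_rep_fun c d a).
Proof.
move=> r x y; rewrite /quot_rep_fun linearP.
exact: (linearP (quot_pi (P d)) (rep_map R a r)).
Qed.

Fact quot_rep_fun_kills c d (a : hom c d) x :
  P c x -> linear_of (@quot_rep_fun_linear c d a) x = 0.
Proof. by move=> Px; apply/quot_pi_eq0/sub_map. Qed.

Definition quot_rep_map c d (a : hom c d) :
    {linear quot_of (P c) -> restrict (conv (rep_map R a)) (quot_of (P d))} :=
  quot_lift (@quot_rep_fun_kills c d a).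

Lemma quot_rep_mapE c d (a : hom c d) x :
  quot_rep_map a (quot_pi (P c) x) = quot_pi (P d) (mod_map N a x) :> quot_of (P d).
Proof. exact: (quot_liftE (@quot_rep_fun_kills c d a) x). Qed.

Definition quot_rep : rep_module R.
Proof.
refine (@RepModule _ _ (fun c => quot_of (P c)) quot_rep_map _ _).
- move=> c q; have [x <-] := quot_pi_surj q.
  by rewrite quot_rep_mapE mod_map1.
- move=> c d e b a q; have [x <-] := quot_pi_surj q.
  by rewrite quot_rep_mapE mod_map_comp (quot_rep_mapE a) (quot_rep_mapE b).
Defined.

Definition quot_rep_pi : morphism N quot_rep :=
  @Morphism _ _ N quot_rep (fun c => quot_pi (P c))
    (fun c d a x => esym (quot_rep_mapE a x)).

End QuotRep.

(** If the adjoint of the quotient kills the class of t, the adjoint of N sends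
    t into P_d, thus to the value of a sum of tensors with left factors in P_c;
    as N is cartesian, t is that sum, whose class is 0.  The criterion is
    visibly stable under sums of submodules, which is what makes a largest
    such P available. *)
Lemma quot_rep_cartesian (N : cart_module R) (P : submodule N) :
    (forall c d (a : hom c d) y, P d y -> spanned a (P c) y) ->
  cartesian (quot_rep P).
Proof.
move=> Pgen; apply: cartesianI => [c d a q|c d a t].
  have [y <-] := quot_pi_surj q.
  have := @cartesian_spanned N c d a y.
  exact: (@spanned_nat _ _ (quot_rep_pi P)).
have [u <-] := tensor_map_surj (@quot_pi_surj _ _ (P c)) t.
rewrite [LHS](adjoint_hom_nat (quot_rep_pi P)) => /quot_pi_eq0/(Pgen c d a)[s [sP Es]].
have -> : u = \sum_(p <- s) tmul p.1 (p.2 : scalars a).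
  apply: (@cartesian_inj N _ _ a); rewrite Es raddf_sum.
  by apply: eq_bigr => p _; rewrite adjoint_hom_tmul.
rewrite raddf_sum big_seq big1 // => p /sP Pp.
rewrite [LHS]tensor_map_tmul (_ : quot_pi _ _ = 0) ?tmul0l //.
exact/quot_pi_eq0.
Qed.

End RepModules.

(** * Small cartesian submodules *)

Section SmallSubmodules.
Context (C : category) (R : representation C).
Local Notation scalars a := (restrict (rep_map R a) (R _)^o).

(** Names for the elements of the smallest submodule that contains two given
    elements of N_c0 and is closed under chosen witnesses of cartesianness:
    [tgen] names the k-th element of N_c used to write an element of N_d in
    terms of the image of N_c, and [trel] the k-th element of N_c needed to
    derive the vanishing of a sum of n tensors.  The family lives in the
    universe of the objects, arrows and rings, so that the submodules named by
    it form a set up to isomorphism. *)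
Inductive term (c0 : ob C) : ob C -> Type :=
| tvar of bool : term c0 c0
| tzero c : term c0 c
| tlin c of R c & term c0 c & term c0 c : term c0 c
| tmap c d (a : hom c d) of term c0 c : term c0 d
| tgen c d (a : hom c d) of term c0 d & nat : term c0 c
| trel c d (a : hom c d) (n : nat) of nat -> term c0 c & nat -> R d & nat : term c0 c.

Section Closure.
Variable N : cart_module R.

Lemma generation_witness c d (a : hom c d) (y : N d) :
  exists s : seq (N c * R d), y = \sum_(p <- s) push a p.1 p.2.
Proof. by have [s [_ ->]] := cartesian_spanned a y; exists s. Qed.

Definition gen_wit c d (a : hom c d) (y : N d) : seq (N c * R d) :=
  projT1 (cid (generation_witness a y)).

Lemma gen_witP c d (a : hom c d) (y : N d) :
  y = \sum_(p <- gen_wit a y) push a p.1 p.2.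
Proof. exact: (projT2 (cid (generation_witness a y))). Qed.

(** Guarding by the vanishing of the sum makes the witness total in s. *)
Lemma relation_witness c d (a : hom c d) (s : seq (N c * R d)) :
  exists w : seq (N c), \sum_(p <- s) tmul p.1 (p.2 : scalars a) = 0 ->
    forall P : submod (N c), (forall x, x \in w -> P x) ->
    \sum_(p <- s) tmul (point_retract P p.1) (p.2 : scalars a) = 0.
Proof.
case: (pselect (\sum_(p <- s) tmul p.1 (p.2 : scalars a) = 0)) => [s0|ns0].
  by have [w hw] := tensor_zero_finite s0; exists w.
by exists [::].
Qed.

Definition rel_wit c d (a : hom c d) (s : seq (N c * R d)) : seq (N c) :=
  projT1 (cid (relation_witness a s)).

Lemma rel_witP c d (a : hom c d) (s : seq (N c * R d)) :
  \sum_(p <- s) tmul p.1 (p.2 : scalars a) = 0 ->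
  forall P : submod (N c), (forall x, x \in rel_wit a s -> P x) ->
    \sum_(p <- s) tmul (point_retract P p.1) (p.2 : scalars a) = 0.
Proof. exact: (projT2 (cid (relation_witness a s))). Qed.

(** Closure under witnesses makes P cartesian: [wc_gen] gives surjectivity of
    the adjoints and [wc_rel] their injectivity. *)
Record witness_closed (P : forall c, N c -> Prop) : Prop := WitnessClosed {
  wc0 : forall c, P c 0;
  wc_lin : forall c (r : (R c)^c) x y, P c x -> P c y -> P c (r *: x + y);
  wc_map : forall c d (a : hom c d) x, P c x -> P d (mod_map N a x : N d);
  wc_gen : forall c d (a : hom c d) y, P d y ->
    forall p, p \in gen_wit a y -> P c p.1;
  wc_rel : forall c d (a : hom c d) s, (forall p, p \in s -> P c p.1) ->
    forall x, x \in rel_wit a s -> P c x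
}.

Definition witness_closed_submodule P (hP : witness_closed P) : submodule N :=
  @Submodule _ _ N (fun c => Submod (@wc0 P hP c) (@wc_lin P hP c)) (@wc_map P hP).

Lemma witness_closed_cartesian P (hP : witness_closed P) :
  cartesian (sub_rep (witness_closed_submodule hP)).
Proof.
set Q := witness_closed_submodule hP; apply: cartesianI => [c d a y|c d a t].
  exists [seq (point_retract (Q c) p.1, p.2) | p <- gen_wit a (sub_incl _ y)].
  split=> //; apply: sub_incl_inj.
  rewrite [LHS](gen_witP a) big_map [RHS]linear_sum big_seq [RHS]big_seq.
  apply: eq_bigr => p /(wc_gen hP (sub_inclP y)) Pp.
  rewrite [RHS](push_nat (sub_rep_incl Q)) [X in _ = push a X _]point_retractK //.
have [s ->] := tensor_sum t; rewrite raddf_sum => s0.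
pose s' : seq (N c * R d) := [seq (sub_incl _ p.1, p.2 : R d) | p <- s].
have s'0 : \sum_(p <- s') tmul p.1 (p.2 : scalars a) = 0.
  apply: (@cartesian_inj _ _ N _ _ a); rewrite raddf0 raddf_sum big_map.
  transitivity (sub_incl (Q d) 0); last by rewrite raddf0.
  rewrite -s0 linear_sum; apply: eq_bigr => p _.
  transitivity (push a (sub_incl (Q c) p.1) p.2 : N d); first exact: adjoint_hom_tmul.
  rewrite -[LHS](push_nat (sub_rep_incl Q)); congr (sub_incl _ _).
  exact: esym (@adjoint_hom_tmul _ _ (sub_rep Q) _ _ a p.1 p.2).
have : \sum_(p <- s') tmul (point_retract (Q c) p.1) (p.2 : scalars a) = 0.
  apply: (rel_witP s'0) => x; apply: (wc_rel hP).
  by move=> _ /mapP[p _ ->]; exact: (sub_inclP (p.1 : sub_of (Q c))).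
rewrite big_map => w0; rewrite -[RHS]w0.
apply: eq_bigr => p _; congr tmul; apply: sub_incl_inj.
by rewrite point_retractK //; apply: sub_inclP.
Qed.

Section Eval.
Variables (c0 : ob C) (g : bool -> N c0).

Fixpoint eval c (t : term c0 c) : N c :=
  match t with
  | tvar b => g b
  | tzero c => 0
  | tlin c r t u => (r : (R c)^c) *: eval t + eval u
  | tmap c d a t => mod_map N a (eval t)
  | tgen c d a t k => (nth (0, 0) (gen_wit a (eval t)) k).1
  | trel c d a n t r k => nth 0 (rel_wit a (mkseq (fun i => (eval (t i), r i)) n)) k
  end.

Definition generated c (x : N c) := exists t : term c0 c, eval t = x.

(** Each closure condition is the evaluation of the matching constructor. *)
Lemma generated_closed : witness_closed generated.
Proof.
split.
- by move=> c; exists (tzero _ c).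
- by move=> c r _ _ [t <-] [u <-]; exists (tlin r t u).
- by move=> c d a _ [t <-]; exists (tmap a t).
- move=> c d a _ [t <-] p ps; exists (tgen a t (index p (gen_wit a (eval t)))).
  by rewrite /= nth_index.
- move=> c d a s sP x xs.
  have /choice[t tE] (i : nat) : exists u : term c0 c, (i < size s)%N ->
      eval u = (nth (0, 0) s i).1.
    case: (ltnP i (size s)) => [si|]; last by exists (tzero _ c).
    by have [u Eu] := sP _ (mem_nth (0, 0) si); exists u.
  exists (trel a (size s) t (fun i => (nth (0, 0) s i).2) (index x (rel_wit a s))).
  rewrite /= (_ : mkseq _ _ = s) ?nth_index //.
  apply: (@eq_from_nth _ (0, 0)); rewrite size_mkseq // => i si.
  by rewrite nth_mkseq // tE //; case: (nth _ _ _).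
Qed.

Lemma generated_min P : witness_closed P -> (forall b, P c0 (g b)) ->
  forall c x, @generated c x -> P c x.
Proof.
move=> hP Pg c _ [t <-].
elim: t => {c} [b|c|c r t IHt u IHu|c d a t IHt|c d a t IHt k|c d a n t IHt r k] /=.
- exact: Pg.
- exact: wc0.
- exact: wc_lin.
- exact: wc_map.
- have [lt|ge] := ltnP k (size (gen_wit a (eval t))).
    exact: (wc_gen hP IHt (mem_nth _ lt)).
  by rewrite nth_default //; apply: wc0.
- set s := mkseq _ _; have [lt|ge] := ltnP k (size (rel_wit a s)).
    apply: (wc_rel hP _ (mem_nth _ lt)) => _ /mapP[i _ ->]; exact: IHt.
  by rewrite nth_default //; apply: wc0.
Qed.

Definition closure : submodule N := witness_closed_submodule generated_closed.

Definition closure_cart : cart_module R :=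
  CartModule (witness_closed_cartesian generated_closed).

Lemma closure_gen b : closure c0 (g b).
Proof. by exists (tvar c0 b). Qed.

End Eval.

(** The witnesses are chosen once and for all in N, independently of the
    generators; this is why closures are monotone, and why the closures of x,
    of y and of any combination of them lie in the closure of x and y. *)
Lemma closure_min c0 c1 (g : bool -> N c0) (g' : bool -> N c1) :
  (forall b, closure g c1 (g' b)) ->
  forall c x, closure g' c x -> closure g c x.
Proof. by move=> gg'; apply: generated_min gg'; apply: generated_closed. Qed.

End Closure.
End SmallSubmodules.

(** * Direct sums *)

Section DependentProduct.
Variables (R : pzRingType) (I : Type) (V : I -> lmodType R).

Definition dprod : Type := forall i, V i.

HB.instance Definition _ := gen_eqMixin dprod.
HB.instance Definition _ := gen_choiceMixin dprod.

Let add (f g : dprod) : dprod := fun i => f i + g i.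
Let opp (f : dprod) : dprod := fun i => - f i.
Let zero : dprod := fun _ => 0.
Let scale (a : R) (f : dprod) : dprod := fun i => a *: f i.

Fact dprod_addA : associative add.
Proof. by move=> f g h; apply: functional_extensionality_dep => i; apply: addrA. Qed.
Fact dprod_addC : commutative add.
Proof. by move=> f g; apply: functional_extensionality_dep => i; apply: addrC. Qed.
Fact dprod_add0 : left_id zero add.
Proof. by move=> f; apply: functional_extensionality_dep => i; apply: add0r. Qed.
Fact dprod_addN : left_inverse zero opp add.
Proof. by move=> f; apply: functional_extensionality_dep => i; apply: addNr. Qed.

HB.instance Definition _ :=
  GRing.isZmodule.Build dprod dprod_addA dprod_addC dprod_add0 dprod_addN.

Fact dprod_scaleA a b f : scale a (scale b f) = scale (a * b) f.
Proof. by apply: functional_extensionality_dep => i; apply: scalerA. Qed.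
Fact dprod_scale1 : left_id 1 scale.
Proof. by move=> f; apply: functional_extensionality_dep => i; apply: scale1r. Qed.
Fact dprod_scaleDr : right_distributive scale +%R.
Proof. by move=> a f g; apply: functional_extensionality_dep => i; apply: scalerDr. Qed.
Fact dprod_scaleDl f : {morph scale^~ f : a b / a + b}.
Proof. by move=> a b; apply: functional_extensionality_dep => i; apply: scalerDl. Qed.

HB.instance Definition _ := GRing.Zmodule_isLmodule.Build R dprod
  dprod_scaleA dprod_scale1 dprod_scaleDr dprod_scaleDl.

End DependentProduct.

Section DirectSum.
Context (C : category) (R : representation C).
Local Notation scalars a := (restrict (rep_map R a) (R _)^o).
Variables (I : choiceType) (S : I -> cart_module R).

Definition prod_rep_fun c d (a : hom c d) (f : dprod (fun i => S i c)) :
    restrict (conv (rep_map R a)) (dprod (fun i => S i d)) :=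
  fun i => mod_map (S i) a (f i).

Fact prod_rep_fun_linear c d (a : hom c d) : linear (@prod_rep_fun c d a).
Proof.
move=> r f g; apply: functional_extensionality_dep => i.
exact: (linearP (mod_map (S i) a)).
Qed.

Definition prod_rep : rep_module R.
Proof.
refine (@RepModule _ _ (fun c => dprod (fun i => S i c))
  (fun c d a => linear_of (@prod_rep_fun_linear c d a)) _ _).
- by move=> c f; apply: functional_extensionality_dep => i; apply: mod_map1.
- by move=> c d e b a f; apply: functional_extensionality_dep => i; apply: mod_map_comp.
Defined.

Definition finite_support c (f : prod_rep c) :=
  exists s : seq I, forall i, i \notin s -> (f : dprod _) i = 0.

Fact finite_support0 c : @finite_support c 0.
Proof. by exists [::]. Qed.

Fact finite_supportZD c (a : (R c)^c) (f g : prod_rep c) :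
  finite_support f -> finite_support g -> finite_support (a *: f + g).
Proof.
move=> [s sf] [s' sg]; exists (s ++ s') => i.
rewrite mem_cat negb_or => /andP[/sf fi /sg gi].
rewrite -[LHS]/(a *: (f : dprod _) i + (g : dprod _) i) fi gi.
by rewrite scaler0 addr0.
Qed.

Fact finite_support_map c d (a : hom c d) (f : prod_rep c) :
  finite_support f -> finite_support (mod_map prod_rep a f : prod_rep d).
Proof.
move=> [s sf]; exists s => i /sf fi.
rewrite -[LHS]/(mod_map (S i) a ((f : dprod _) i) : S i d) fi.
exact: (linear0 (mod_map (S i) a)).
Qed.

Definition finite_supports : submodule prod_rep :=
  @Submodule _ _ prod_rep
    (fun c => Submod (@finite_support0 c) (@finite_supportZD c)) finite_support_map.

Definition dsum : rep_module R := sub_rep finite_supports.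

Definition component i c (x : dsum c) : S i c := (sub_incl _ x : dprod _) i.

Lemma component_inj c (x y : dsum c) :
  (forall i, component i x = component i y) -> x = y.
Proof.
by move=> xy; apply: sub_incl_inj; apply: functional_extensionality_dep.
Qed.

Fact component_linear i c : linear (@component i c).
Proof. by move=> a x y; rewrite /component linearP. Qed.

Lemma componentD i c (x y : dsum c) :
  component i (x + y) = component i x + component i y.
Proof. exact: (linearD (linear_of (@component_linear i c))). Qed.

Lemma componentZ i c (a : (R c)^c) (x : dsum c) :
  component i (a *: x) = a *: component i x.
Proof. exact: (linearZ_LR (linear_of (@component_linear i c))). Qed.

Definition dsum_component i : morphism dsum (S i) :=
  @Morphism _ _ dsum (S i) (fun c => linear_of (@component_linear i c))
    (fun _ _ _ _ => erefl).

Definition inject i c (x : S i c) : prod_rep c := dfwith (fun j => 0 : S j c) x.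

Lemma injectP i c (x : S i c) : finite_support (inject x).
Proof. by exists [:: i] => j; rewrite inE eq_sym => ij; apply: dfwith_out. Qed.

Fact inject_linear i c : linear (@inject i c).
Proof.
move=> a x y; apply: functional_extensionality_dep => j.
rewrite -[RHS]/(a *: inject x j + inject y j) /inject.
case: (eqVneq i j) => [ij|ij]; last by rewrite !dfwith_out // scaler0 addr0.
by case: _ / ij; rewrite !dfwith_in.
Qed.

Definition dsum_inject_fun i c : {linear S i c -> dsum c} :=
  @corestrict _ _ _ (finite_supports c) (linear_of (@inject_linear i c)) (@injectP i c).

Lemma component_inject i c (x : S i c) : component i (dsum_inject_fun i c x) = x.
Proof. exact: dfwith_in. Qed.

Lemma component_inject_neq i j c (x : S i c) :
  i != j -> component j (dsum_inject_fun i c x) = 0.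
Proof. exact: dfwith_out. Qed.

Fact dsum_inject_nat i c d (a : hom c d) (x : S i c) :
  dsum_inject_fun i d (mod_map (S i) a x) =
  mod_map dsum a (dsum_inject_fun i c x) :> dsum d.
Proof.
apply: component_inj => j; rewrite [RHS](mor_nat (dsum_component j)) /=.
case: (eqVneq i j) => [ij|ij]; last first.
  by rewrite !component_inject_neq // [RHS](linear0 (mod_map (S j) a)).
by case: _ / ij; rewrite !component_inject.
Qed.

Definition dsum_inject i : morphism (S i) dsum :=
  @Morphism _ _ (S i) dsum (dsum_inject_fun i) (@dsum_inject_nat i).

Definition supported c (s : seq I) (x : dsum c) :=
  forall i, i \notin s -> component i x = 0.

Lemma supportedW c s s' (x : dsum c) :
  {subset s <= s'} -> supported s x -> supported s' x.
Proof. by move=> ss' sx i is'; apply: sx; apply: contra is'; apply: ss'. Qed.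

Lemma dsum_supported c (x : dsum c) : exists s, uniq s /\ supported s x.
Proof.
have [s sx] := sub_inclP x; exists (undup s); split; first exact: undup_uniq.
by move=> i; rewrite mem_undup => /sx.
Qed.

Lemma dsum_decompose c (s : seq I) (x : dsum c) : uniq s -> supported s x ->
  x = \sum_(i <- s) dsum_inject i c (component i x).
Proof.
move=> us sx; apply: component_inj => j.
rewrite [RHS](raddf_sum (linear_of (@component_linear j c))) /=.
case: (boolP (j \in s)) => [js|njs]; last first.
  rewrite sx // big_seq big1 // => i si; apply: component_inject_neq.
  by apply: contraNneq njs => <-.
rewrite (bigD1_seq j) //= component_inject big1 ?addr0 // => i ij.
exact: component_inject_neq.
Qed.

(** Surjectivity of the adjoint is checked on each component.  For injectivity,
    a tensor over the sum is the sum of its finitely many components, each of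
    which the adjoint of the corresponding summand sends to 0. *)
Lemma dsum_cartesian : cartesian dsum.
Proof.
apply: cartesianI => [c d a y|c d a t].
  have [s [us sy]] := dsum_supported y; rewrite (dsum_decompose us sy).
  elim: s {us sy} => [|i s IH]; first by rewrite big_nil; exists [::]; rewrite big_nil.
  rewrite big_cons; apply: spannedD IH.
  exact: (spanned_nat (f := dsum_inject i) (fun _ => id) (cartesian_spanned a _)).
move=> t0; have [s [us ->]] : exists s, uniq s /\
    t = \sum_(i <- s)
      tensor_map (dsum_inject i c) _ (tensor_map (dsum_component i c) _ t).
  have [l ->] := tensor_sum t.
  have [s [us sl]] : exists s, uniq s /\ forall p, p \in l -> supported s p.1.
    elim: l {t t0} => [|p l [s [us sl]]]; first by exists [::].
    have [s' [us' sp]] := dsum_supported p.1; exists (undup (s ++ s')).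
    split=> [|q]; first exact: undup_uniq.
    rewrite inE => /orP[/eqP->|/sl sq].
      by apply: supportedW sp => i; rewrite mem_undup mem_cat orbC => ->.
    by apply: supportedW sq => i; rewrite mem_undup mem_cat => ->.
  exists s; split=> //; pose F i (p : dsum c * scalars a) :=
    tmul (dsum_inject i c (dsum_component i c p.1)) p.2.
  transitivity (\sum_(p <- l) \sum_(i <- s) F i p).
    rewrite big_seq [RHS]big_seq; apply: eq_bigr => p /sl sp.
    by rewrite {1}(dsum_decompose us sp) tmul_suml.
  rewrite exchange_big /=; apply: eq_bigr => i _.
  by rewrite !tensor_map_sum; apply: eq_bigr => p _; rewrite !tensor_map_tmul.
rewrite big1 // => i _.
rewrite (_ : tensor_map (dsum_component i c) _ t = 0) ?tensor_map0 //.
apply: (@cartesian_inj _ _ (S i) _ _ a); rewrite adjoint_hom_nat raddf0.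
by rewrite t0 linear0.
Qed.

End DirectSum.

(** * Pairings, and the sum of all small modules with a pairing *)

Section Pairings.
Context (C : category) (R : representation C) (A : forall c, lmodType (R c)).

(** A pairing of N with the A_c, written as balanced maps rather than as
    homomorphisms on tensor products, so that pulling back is composition. *)
Record pairing (N : rep_module R) := Pairing {
  pair_fun :> forall c, N c -> A c -> QmodZ;
  pair_balanced : forall c, balanced (@pair_fun c)
}.

Fact pull_balanced (N L : rep_module R) (h : morphism N L) (s : pairing L) c :
  balanced (fun (x : N c) a => s c (h c x) a).
Proof.
have [sD sDr sZ] := pair_balanced s c.
by split=> *; rewrite ?linearD ?linearZ ?sD ?sDr ?sZ.
Qed.

Definition pull (N L : rep_module R) (h : morphism N L) (s : pairing L) : pairing N :=
  Pairing (pull_balanced h s).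

Section DsumPairing.
Variables (I : choiceType) (S : I -> cart_module R) (s : forall i, pairing (S i)).
Local Notation B := (dsum S).

Let value c (a : A c) (x : B c) i := s i c (component i x) a.
Let supp c (x : B c) : seq I := projT1 (cid (dsum_supported x)).

Let sum_supported c (a : A c) (x : B c) l l' : uniq l -> uniq l' ->
    supported l x -> {subset l <= l'} ->
  \sum_(i <- l) value a x i = \sum_(i <- l') value a x i.
Proof.
move=> ul ul' lx ll'; rewrite [RHS](bigID (mem l)) /= [X in _ = _ + X]big1 ?addr0.
  rewrite -[RHS]big_filter; apply: perm_big; apply: uniq_perm => //.
    exact: filter_uniq.
  by move=> i; rewrite mem_filter; case: (boolP (i \in l)) => // /ll' ->.
by move=> i /lx ix; rewrite /value ix; apply: balanced0l; apply: pair_balanced.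
Qed.

(** The support is a chosen one; any other finite support gives the same sum. *)
Definition dsum_pairing_fun c (x : B c) (a : A c) : QmodZ :=
  \sum_(i <- supp x) value a x i.

Let dsum_pairing_sum c (x : B c) (a : A c) l : uniq l -> supported l x ->
  dsum_pairing_fun x a = \sum_(i <- l) value a x i.
Proof.
move=> ul lx; have [us sx] := projT2 (cid (dsum_supported x)).
rewrite /dsum_pairing_fun -/(supp x) in us sx *.
pose m := undup (supp x ++ l).
transitivity (\sum_(i <- m) value a x i); last apply: esym;
  apply: sum_supported; rewrite ?undup_uniq // => i;
  by rewrite mem_undup mem_cat => ->; rewrite ?orbT.
Qed.

Let common_support c (x y : B c) : exists l,
  [/\ uniq l, supported l x & supported l y].
Proof.
have [l [_ lx]] := dsum_supported x; have [l' [_ ly]] := dsum_supported y.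
exists (undup (l ++ l')); split; rewrite ?undup_uniq //.
  by apply: supportedW lx => i; rewrite mem_undup mem_cat => ->.
by apply: supportedW ly => i; rewrite mem_undup mem_cat orbC => ->.
Qed.

Fact dsum_pairing_balanced c : balanced (@dsum_pairing_fun c).
Proof.
split=> [x y a|x a b|r x a].
- have [l [ul lx ly]] := common_support x y.
  rewrite !(@dsum_pairing_sum _ _ _ l) //; last first.
    by move=> i il; rewrite componentD lx ?ly ?addr0.
  rewrite -big_split /=; apply: eq_bigr => i _; have [sD _ _] := pair_balanced (s i) c.
  by rewrite /value -sD componentD.
- rewrite -big_split /=; apply: eq_bigr => i _.
  by have [_ sD _] := pair_balanced (s i) c; apply: sD.
- have [l [ul lx]] := dsum_supported x.
  rewrite !(@dsum_pairing_sum _ _ _ l) //; last first.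
    by move=> i il; rewrite componentZ lx ?scaler0.
  apply: eq_bigr => i _; have [_ _ sZ] := pair_balanced (s i) c.
  by rewrite /value -sZ componentZ.
Qed.

Definition dsum_pairing : pairing B := Pairing dsum_pairing_balanced.

Lemma dsum_pairing_inject i c (x : S i c) a :
  dsum_pairing c (dsum_inject S i c x) a = s i c x a.
Proof.
rewrite [LHS](@dsum_pairing_sum _ _ _ [:: i]) //.
  by rewrite big_seq1 /value component_inject.
by move=> j; rewrite inE eq_sym => /component_inject_neq.
Qed.

End DsumPairing.

(** The evaluation bounds the size of the module by that of the type of terms. *)
Record presentation (c0 : ob C) := Presentation {
  pres_mod : cart_module R;
  pres_val : forall c, term R c0 c -> pres_mod c;
  pres_surj : forall c x, exists t, @pres_val c t = x;
  pres_lin : forall c r t u,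
    @pres_val c (tlin r t u) = (r : (R c)^c) *: @pres_val c t + @pres_val c u;
  pres_map : forall c d (a : hom c d) t,
    @pres_val d (tmap a t) = mod_map pres_mod a (@pres_val c t);
  pres_pair : pairing pres_mod
}.

(** A presentation is determined up to isomorphism by the kernel of its
    evaluation and by the pairing of the evaluated terms; unlike the
    presentations themselves, these data form a small type. *)
Definition code_type c0 : Type := ((forall c, term R c0 c -> term R c0 c -> Prop) *
  (forall c, term R c0 c -> A c -> QmodZ))%type.

Definition code c0 (p : presentation c0) : code_type c0 :=
  (fun c t u => pres_val p t = pres_val p u,
   fun c t a => pres_pair p c (pres_val p t) a).

Lemma code_morphism c0 (p p' : presentation c0) : code p = code p' ->
  exists f : morphism (pres_mod p) (pres_mod p'),
    forall c x a, pres_pair p' c (f c x) a = pres_pair p c x a.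
Proof.
move=> [Ekr Epr].
have kr c t u :
    pres_val p (c := c) t = pres_val p u -> pres_val p' t = pres_val p' u.
  by move=> Etu; have := congr1 (fun k => k c t u) Ekr; rewrite /= => <-.
pose f c x := pres_val p' (projT1 (cid (@pres_surj _ p c x))).
(* f is independent of the term chosen, as both kernels are the same. *)
have fE c t : f c (pres_val p t) = pres_val p' t.
  exact: (kr _ _ _ (projT2 (cid (pres_surj _)))).
have lin_f c : linear (f c).
  move=> r x y; have [t <-] := pres_surj x; have [u <-] := pres_surj y.
  by rewrite -pres_lin !fE pres_lin.
have nat_f c d (a : hom c d) x :
    f d (mod_map (pres_mod p) a x) = mod_map (pres_mod p') a (f c x) :> pres_mod p' d.
  by have [t <-] := pres_surj x; rewrite -pres_map !fE pres_map.
exists (@Morphism _ _ (pres_mod p) (pres_mod p') (fun c => linear_of (lin_f c)) nat_f).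
move=> c x a; have [t <-] := pres_surj x; rewrite [X in pres_pair p' c X]fE.
exact: esym (congr1 (fun h => h c t a) Epr).
Qed.

Definition realized_code : Type :=
  {c0 : ob C & {k : code_type c0 | exists p, code p = k}}.

Definition realize (i : {classic realized_code}) :
    presentation (projT1 (i : realized_code)) :=
  projT1 (cid (projT2 (projT2 (i : realized_code)))).

Lemma realizeP (i : {classic realized_code}) :
  code (realize i) = projT1 (projT2 (i : realized_code)).
Proof. exact: (projT2 (cid (projT2 (projT2 (i : realized_code))))). Qed.

Local Notation summand i := (pres_mod (realize i)).
Definition presented_sum : cart_module R :=
  CartModule (dsum_cartesian (fun i => summand i)).
Definition presented_sum_pairing : pairing presented_sum :=
  dsum_pairing (fun i => pres_pair (realize i)).

Lemma presented_sum_receives c0 (p : presentation c0) :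
  exists f : morphism (pres_mod p) presented_sum,
    forall c x a, presented_sum_pairing c (f c x) a = pres_pair p c x a.
Proof.
pose i : {classic realized_code} := existT _ c0 (exist _ (code p) (ex_intro _ p erefl)).
have [f fE] := code_morphism (esym (realizeP i) : code p = _).
exists (mor_comp (dsum_inject (fun i => summand i) i) f) => c x a.
rewrite -fE; exact: (dsum_pairing_inject (fun i => pres_pair (realize i))).
Qed.

End Pairings.

(** * The module representing pairings *)

Section Terminal.
Context (C : category) (R : representation C) (A : forall c, lmodType (R c)).
Local Notation scalars a := (restrict (rep_map R a) (R _)^o).
Local Notation B := (presented_sum A).
Local Notation sB := (presented_sum_pairing A).

(** The submodules by which a cartesian module can be divided without leaving
    the cartesian modules, see [quot_rep_cartesian]. *)
Definition self_generated (N : rep_module R) (K : submodule N) :=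
  forall c d (a : hom c d) y, K d y -> spanned a (K c) y.

Definition annihilated (N : rep_module R) (s : pairing A N) (K : submodule N) :=
  forall c x a, K c x -> s c x a = 0.

Definition redundant c (x : B c) := exists K : submodule B,
  [/\ self_generated K, annihilated sB K & K c x].

Fact redundant0 c : @redundant c 0.
Proof.
have ZD c1 (r : (R c1)^c) (x y : B c1) : x = 0 -> y = 0 -> r *: x + y = 0.
  by move=> -> ->; rewrite scaler0 addr0.
have Zmap c1 d (a : hom c1 d) (x : B c1) : x = 0 -> mod_map B a x = 0 :> B d.
  by move=> ->; apply: (linear0 (mod_map B a)).
exists (@Submodule _ _ B (fun c => Submod (erefl (0 : B c)) (@ZD c)) Zmap).
split=> // [c1 d a y ->|c1 x a ->].
  by exists [::]; rewrite big_nil.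
by apply: balanced0l; apply: pair_balanced.
Qed.

(** The sum of two self-generated annihilated submodules is of the same kind. *)
Fact redundantZD c (r : (R c)^c) (x y : B c) :
  redundant x -> redundant y -> redundant (r *: x + y).
Proof.
move=> [K [genK annK Kx]] [L [genL annL Ly]].
pose KL c z := exists x y, [/\ K c x, L c y & z = x + y].
have KL0 c1 : KL c1 0 by exists 0, 0; rewrite addr0; split=> //; apply: sm0.
have KLZD c1 (q : (R c1)^c) z z' : KL c1 z -> KL c1 z' -> KL c1 (q *: z + z').
  move=> [u [v [Ku Lv ->]]] [u' [v' [Ku' Lv' ->]]].
  exists (q *: u + u'), (q *: v + v'); split; try exact: smZD.
  by rewrite scalerDr addrACA.
have KLmap c1 d (a : hom c1 d) z : KL c1 z -> KL d (mod_map B a z : B d).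
  move=> [u [v [Ku Lv ->]]]; exists (mod_map B a u), (mod_map B a v).
  by split; try exact: sub_map; apply: (linearD (mod_map B a)).
exists (@Submodule _ _ B (fun c1 => Submod (KL0 c1) (@KLZD c1)) KLmap); split.
- move=> c1 d a _ [u [v [/(genK _ _ a) Ku /(genL _ _ a) Lv ->]]].
  apply: spannedD; [apply: spanned_sub Ku | apply: spanned_sub Lv] => w Pw.
    by exists w, 0; rewrite addr0; split=> //; apply: sm0.
  by exists 0, w; rewrite add0r; split=> //; apply: sm0.
- move=> c1 _ a [u [v [Ku Lv ->]]]; have [sD _ _] := pair_balanced sB c1.
  by rewrite sD annK // annL // addr0.
- by exists (r *: x), y; split=> //; apply: smZ.
Qed.

Fact redundant_map c d (a : hom c d) (x : B c) :
  redundant x -> redundant (mod_map B a x : B d).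
Proof. by move=> [K [genK annK Kx]]; exists K; split=> //; apply: sub_map. Qed.

Definition redundant_submodule : submodule B :=
  @Submodule _ _ B (fun c => Submod (@redundant0 c) (@redundantZD c)) redundant_map.

Lemma redundant_generated : self_generated redundant_submodule.
Proof.
move=> c d a y [K [genK annK /(genK _ _ a)]]; apply: spanned_sub => x Kx.
by exists K.
Qed.

Lemma redundant_annihilated : annihilated sB redundant_submodule.
Proof. by move=> c x a [K [_ annK /annK]]. Qed.

Definition terminal : cart_module R :=
  CartModule (quot_rep_cartesian redundant_generated).
Local Notation E := terminal.
Definition terminal_pi : morphism B E := quot_rep_pi redundant_submodule.

Lemma terminal_pi_surj c (q : E c) : exists x, terminal_pi c x = q.
Proof. exact: quot_pi_surj. Qed.

Lemma terminal_pi_eq0 c (x : B c) : terminal_pi c x = 0 <-> redundant_submodule c x.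
Proof. exact: quot_pi_eq0. Qed.

Definition terminal_pairing_fun c (q : E c) (a : A c) : QmodZ :=
  sB c (projT1 (cid (terminal_pi_surj q))) a.

Lemma terminal_pairing_pi c (x : B c) (a : A c) :
  terminal_pairing_fun (terminal_pi c x) a = sB c x a.
Proof.
rewrite /terminal_pairing_fun.
have Ey := projT2 (cid (terminal_pi_surj (terminal_pi c x))).
move: (projT1 _) Ey => y Ey.
apply/subr0_eq; rewrite -(balancedBl _ _ _ (pair_balanced sB c)).
by apply/redundant_annihilated/terminal_pi_eq0; rewrite linearB Ey subrr.
Qed.

Fact terminal_pairing_balanced c : balanced (@terminal_pairing_fun c).
Proof.
have [sD sDr sZ] := pair_balanced sB c.
split=> [x y a|x a b|r x a]; have [x' <-] := terminal_pi_surj x.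
- have [y' <-] := terminal_pi_surj y.
  by rewrite -linearD !terminal_pairing_pi sD.
- by rewrite !terminal_pairing_pi sDr.
- by rewrite -linearZ !terminal_pairing_pi sZ.
Qed.

Definition terminal_pairing : pairing A E := Pairing terminal_pairing_balanced.
Local Notation u := terminal_pairing.

(** The preimage K in B of the image of h - h' is self-generated, because the
    image of a cartesian module is, and because the kernel of B -> E is; it
    pairs to 0.  So the construction of E has already divided it out. *)
Theorem terminal_unique (L : cart_module R) (h h' : morphism L E) :
  (forall c x a, u c (h c x) a = u c (h' c x) a) -> mor_eq h h'.
Proof.
move=> uhh'.
pose K c (y : B c) := exists x, terminal_pi c y = h c x - h' c x.
have hh0 c : h c 0 - h' c 0 = 0 by rewrite (linear0 (h c)) (linear0 (h' c)) subrr.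
have K0 c : K c 0 by exists 0; rewrite hh0; apply: linear0.
have KZD c (r : (R c)^c) y z : K c y -> K c z -> K c (r *: y + z).
  move=> [x Ex] [x' Ex']; exists (r *: x + x').
  rewrite (linearP (terminal_pi c)) (linearP (h c)) (linearP (h' c)) Ex Ex'.
  by rewrite scalerBr opprD addrACA.
have Kmap c d (a : hom c d) y : K c y -> K d (mod_map B a y : B d).
  move=> [x Ex]; exists (mod_map L a x); rewrite !mor_nat Ex.
  exact: (linearB (mod_map E a)).
pose KK := @Submodule _ _ B (fun c => Submod (K0 c) (@KZD c)) Kmap.
suff KJ c y : K c y -> redundant_submodule c y.
  move=> c x; apply/subr0_eq.
  have [y Ey] := terminal_pi_surj (h c x - h' c x).
  by rewrite -Ey; apply/terminal_pi_eq0/KJ; exists x.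
move=> Ky; exists KK; split=> //.
- move=> {}c d a {Ky}y [x Ex].
  have [s [_ Es]] := cartesian_spanned a x.
  have /choice[lift liftE] (z : L c) : exists w, terminal_pi c w = h c z - h' c z.
    exact: terminal_pi_surj.
  pose y' := \sum_(p <- s) push a (lift p.1) p.2.
  rewrite -[y](subrK y'); apply: spannedD; last first.
    exists [seq (lift p.1, p.2) | p <- s]; split; last by rewrite big_map.
    by move=> _ /mapP[p _ ->]; exists p.1; apply: liftE.
  have : redundant_submodule d (y - y').
    apply/terminal_pi_eq0; rewrite linearB Ex Es (linear_sum (h d)) (linear_sum (h' d)).
    rewrite (linear_sum (terminal_pi d)) -sumrB.
    apply/eqP; rewrite subr_eq0; apply/eqP/eq_bigr => p _.
    by rewrite !push_nat liftE /push (linearB (mod_map E a)) scalerBr.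
  move=> /(redundant_generated a); apply: spanned_sub => z Jz.
  by exists 0; rewrite hh0; apply/terminal_pi_eq0.
- move=> {}c {Ky}y a [x Ex]; rewrite -terminal_pairing_pi Ex.
  rewrite -[LHS]/(u c (h c x - h' c x) a).
  by rewrite (balancedBl _ _ _ (pair_balanced u c)) uhh' subrr.
Qed.

Section Existence.
Variables (N : cart_module R) (s : pairing A N).

Definition closure_presentation c0 (g : bool -> N c0) : presentation A c0.
Proof.
refine (@Presentation _ _ A c0 (closure_cart g)
  (fun c t => @sub_mk _ _ (closure g c) (eval g t) (ex_intro _ t erefl)) _ _ _
  (pull (sub_rep_incl (closure g)) s)).
- move=> c x; have [t Et] := sub_inclP x; exists t.
  by apply: sub_incl_inj; rewrite -Et.
- by move=> c r t t'; apply: sub_incl_inj.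
- by move=> c d a t; apply: sub_incl_inj.
Defined.

Lemma closure_to_terminal c0 (g : bool -> N c0) :
  exists f : morphism (closure_cart g) E,
    forall c x a, u c (f c x) a = s c (sub_rep_incl (closure g) c x) a.
Proof.
have [f fE] := presented_sum_receives (closure_presentation g).
exists (mor_comp terminal_pi f) => c x a.
by rewrite -[LHS]/(terminal_pairing_fun _ _) terminal_pairing_pi fE.
Qed.

(** Each element x of N is sent to its image under the map of [closure_to_terminal]
    from the closure of x.  By [terminal_unique] the value does not change when
    it is computed in the closure of two elements, one of them x, where
    linearity can be read off. *)
Theorem terminal_exists : exists h : morphism N E,
  forall c x a, u c (h c x) a = s c x a.
Proof.
pose m c0 g := projT1 (cid (@closure_to_terminal c0 g)).
have mE c0 g c x a : u c (m c0 g c x) a = s c (sub_rep_incl (closure g) c x) a.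
  exact: (projT2 (cid (closure_to_terminal g))).
pose pt c (x y : N c) (b : bool) := if b then x else y.
pose self c (x : N c) : closure_cart (pt c x x) c :=
  sub_mk (closure_gen (pt c x x) true).
pose h c x := m c (pt c x x) c (self c x).
have mh c0 (g : bool -> N c0) c (z : closure_cart g c) :
    m c0 g c z = h c (sub_incl _ z).
  set x := sub_incl _ z.
  have sub c' w : closure (pt c x x) c' w -> closure g c' w.
    by apply: closure_min; case; apply: sub_inclP.
  pose incl : morphism (closure_cart (pt c x x)) (closure_cart g) :=
    sub_rep_corestrict (f := sub_rep_incl (closure (pt c x x)))
      (fun c' w => sub c' _ (sub_inclP w)).
  have Ez : z = incl c (self c x) by apply: sub_incl_inj.
  have mm : mor_eq (m c (pt c x x)) (mor_comp (m c0 g) incl).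
    by apply: terminal_unique => c' w a; rewrite [LHS]mE [RHS]mE.
  exact: etrans (congr1 (m c0 g c) Ez) (esym (mm c (self c x))).
have lin_h c : linear (h c).
  move=> r x y; pose g := pt c x y.
  pose gx : closure_cart g c := sub_mk (closure_gen g true).
  pose gy : closure_cart g c := sub_mk (closure_gen g false).
  by rewrite -(mh _ g c gx) -(mh _ g c gy) -linearP mh.
have nat_h c d (a : hom c d) x :
    h d (mod_map N a x) = mod_map E a (h c x) :> E d.
  have := mh _ (pt c x x) d (mod_map (closure_cart (pt c x x)) a (self c x)).
  by rewrite mor_nat => <-.
exists (@Morphism _ _ N E (fun c => linear_of (lin_h c)) nat_h) => c x a.
exact: mE.
Qed.

End Existence.
End Terminal.

(** * Characters *)

Section Characters.
Variables (R : pzRingType) (M : lmodType R^c).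

Definition character : Type := {f : M -> QmodZ | zmod_morphism f}.

HB.instance Definition _ := gen_eqMixin character.
HB.instance Definition _ := gen_choiceMixin character.

Definition char_val (f : character) : {additive M -> QmodZ} :=
  HB.pack (sval f) (GRing.isZmodMorphism.Build M QmodZ (sval f) (svalP f)).

Lemma char_ext (f g : character) : char_val f =1 char_val g -> f = g.
Proof.
by move: f g => [f ?] [g ?] fg; apply/eq_exist/funext => x; apply: fg.
Qed.

Definition char_mk (f : {additive M -> QmodZ}) : character :=
  exist _ (f : M -> QmodZ) (raddfB f).

Fact char_add_subproof (f g : character) :
  zmod_morphism (fun x => char_val f x + char_val g x).
Proof. by move=> x y; rewrite !raddfB opprD addrACA. Qed.
Fact char_opp_subproof (f : character) : zmod_morphism (fun x => - char_val f x).
Proof. by move=> x y; rewrite raddfB !opprB opprK addrC. Qed.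
Fact char_zero_subproof : zmod_morphism (fun _ : M => 0 : QmodZ).
Proof. by move=> x y; rewrite subrr. Qed.
Fact char_scale_subproof (a : R) (f : character) :
  zmod_morphism (fun x => char_val f ((a : R^c) *: x)).
Proof. by move=> x y; rewrite scalerBr raddfB. Qed.

Let add f g : character := exist _ _ (char_add_subproof f g).
Let opp f : character := exist _ _ (char_opp_subproof f).
Let zero : character := exist _ _ char_zero_subproof.
Let scale a f : character := exist _ _ (char_scale_subproof a f).

Fact char_addA : associative add.
Proof. by move=> f g h; apply: char_ext => x; apply: addrA. Qed.
Fact char_addC : commutative add.
Proof. by move=> f g; apply: char_ext => x; apply: addrC. Qed.
Fact char_add0 : left_id zero add.
Proof. by move=> f; apply: char_ext => x; apply: add0r. Qed.
Fact char_addN : left_inverse zero opp add.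
Proof. by move=> f; apply: char_ext => x; apply: addNr. Qed.

HB.instance Definition _ :=
  GRing.isZmodule.Build character char_addA char_addC char_add0 char_addN.

Fact char_scaleA a b f : scale a (scale b f) = scale (a * b) f.
Proof. by apply: char_ext => x; congr (sval f _); apply: (scalerA (b : R^c) a x). Qed.
Fact char_scale1 : left_id 1 scale.
Proof. by move=> f; apply: char_ext => x; congr (sval f _); apply: (scale1r x). Qed.
Fact char_scaleDr : right_distributive scale +%R.
Proof. by move=> a f g; apply: char_ext. Qed.
Fact char_scaleDl f : {morph scale^~ f : a b / a + b}.
Proof.
move=> a b; apply: char_ext => x.
by rewrite -[LHS]/(char_val f (((a : R^c) + (b : R^c)) *: x)) scalerDl raddfD.
Qed.

HB.instance Definition _ := GRing.Zmodule_isLmodule.Build R character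
  char_scaleA char_scale1 char_scaleDr char_scaleDl.

Lemma char_eval_balanced : balanced (fun (x : M) (f : character) => char_val f x).
Proof. by split=> // x y f; apply: raddfD. Qed.

(** A linear map j along which all characters of M extend, compatibly with sums
    and scalars, is pure. *)
Section Detect.
Variables (E : lmodType R^c) (j : {linear M -> E}) (u : E -> character -> QmodZ).
Hypotheses (bal_u : balanced u) (uj : forall x f, u (j x) f = char_val f x).

Lemma detected_injective : injective j.
Proof.
apply: raddf_inj => x jx0; apply: contrapT => x0.
have [|y z -> ->|f [_ /eqP fx]] := @QmodZ_separates _ (fun y => y = 0) x _ _ x0.
- by [].
- by rewrite subrr.
by apply: fx; rewrite -[LHS]/(char_val (char_mk f) x) -uj jx0; apply: balanced0l.
Qed.

(** A character f of M (x) X is a family of characters f (- (x) x) of M that is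
    linear in x; extending each of them to E extends f, so that no t with
    f t <> 0 can vanish in E (x) X. *)
Lemma detected_tensor_injective X : injective (tensor_map j X).
Proof.
apply: (@raddf_inj _ _ (tensor_map j X)) => t jt0; apply: contrapT => t0.
have [|y z -> ->|f [_ /eqP ft]] := @QmodZ_separates _ (fun y => y = 0) t _ _ t0.
- by [].
- by rewrite subrr.
have slice_additive (x : X) : zmod_morphism (fun m => f (tmul m x)).
  by move=> m m'; rewrite tmulBl raddfB.
pose slice x : character := exist _ _ (slice_additive x).
have [uD uDr uZ] := bal_u.
have bal : balanced (fun e x => u e (slice x)).
  split=> [e e' x|e x y|a e x]; first exact: uD.
    rewrite -uDr; congr (u e _); apply: char_ext => m.
    by rewrite -[LHS]/(f _) tmulDr raddfD.
  by rewrite uZ; congr (u e _); apply: char_ext => m; rewrite -[RHS]/(f _) -tmulZ.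
apply: ft; have <- : tensor_hom bal (tensor_map j X t) = f t.
  elim/tensor_ind: {t0 jt0} t => [t t' IHt IHt'|m x].
    by rewrite tensor_mapB !raddfB /= IHt IHt'.
  by rewrite tensor_map_tmul tensor_hom_tmul uj.
by rewrite jt0 raddf0.
Qed.

End Detect.
End Characters.

(** * Pure monomorphisms and pure-injective modules *)

Section PureMonos.
Context (C : category) (R : representation C).

Definition pure_mono (N L : rep_module R) (f : morphism N L) :=
  forall c, injective (f c) /\ forall X, injective (tensor_map (f c) X).

Lemma pure_mono_cancel (N L K : rep_module R) (f : morphism N L) (g : morphism L K)
    (h : morphism N K) :
  (forall c x, h c x = g c (f c x)) -> pure_mono h -> pure_mono f.
Proof.
move=> hE hp c; have [inj injX] := hp c; split=> [x y fxy|X t t' ftt'].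
  by apply: inj; rewrite !hE fxy.
by apply: injX; rewrite -!(tensor_map_comp (hE c)) ftt'.
Qed.

Lemma cart_pure_exact_mono (N M L : cart_module R) (f : morphism N M)
  (g : morphism M L) : cart_pure_exact f g -> pure_mono f.
Proof.
by move=> ex c; have [[inj _ _] exX] := ex c; split=> // X; have [] := exX X.
Qed.

(** The image of N is self-generated since N is cartesian, so the quotient of M
    by it is cartesian; tensoring stays exact on the left by purity and on the
    right in any case. *)
Lemma pure_mono_cokernel (N M : cart_module R) (f : morphism N M) : pure_mono f ->
  exists (L : cart_module R) (g : morphism M L), cart_pure_exact f g.
Proof.
move=> fp; pose K c (y : M c) := exists x, f c x = y.
have K0 c : K c 0 by exists 0; apply: linear0.
have KZD c (r : (R c)^c) y z : K c y -> K c z -> K c (r *: y + z).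
  by move=> [x <-] [x' <-]; exists (r *: x + x'); apply: linearP.
have Kmap c d (a : hom c d) y : K c y -> K d (mod_map M a y : M d).
  by move=> [x <-]; exists (mod_map N a x); apply: mor_nat.
pose I : submodule M := @Submodule _ _ M (fun c => Submod (K0 c) (@KZD c)) Kmap.
have Igen c d (a : hom c d) y : I d y -> spanned a (I c) y.
  move=> [x <-]; apply: (spanned_nat (f := f) _ (cartesian_spanned a x)).
  by move=> z _; exists z.
exists (CartModule (quot_rep_cartesian Igen)), (quot_rep_pi I) => c.
have [inj injX] := fp c.
have ex y : quot_rep_pi I c y = 0 <-> exists x, f c x = y by exact: quot_pi_eq0.
have surj z : exists y, quot_rep_pi I c y = z by exact: quot_pi_surj.
split; first by split.
move=> X; split; first exact: injX.
  exact: tensor_map_exact.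
exact: tensor_map_surj.
Qed.

Section Extension.
Variable A : forall c, lmodType (R c).

(** By purity the tensor product of N_c with A_c embeds in that of L_c with A_c,
    and Q/Z is injective. *)
Lemma pairing_extension (N L : rep_module R) (f : morphism N L) (s : pairing A N) :
  pure_mono f -> exists s' : pairing A L, forall c x a, s' c (f c x) a = s c x a.
Proof.
move=> fp.
have ext c : exists h : {additive tensor (L c) (A c) -> QmodZ},
    forall x a, h (tmul (f c x) a) = s c x a.
  pose sh := tensor_hom (pair_balanced s c).
  pose D y t := exists z, tensor_map (f c) (A c) z = y /\ sh z = t.
  have [|h hD] := @QmodZ_injective _ D.
    split.
    - by exists 0; rewrite !raddf0.
    - move=> _ _ _ _ [z [<- <-]] [z' [<- <-]]; exists (z - z').
      by rewrite tensor_mapB raddfB.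
    - move=> t [z [fz0 <-]].
      rewrite (_ : z = 0) ?raddf0 //; have [_ /(_ (A c)) inj] := fp c.
      by apply: inj; rewrite fz0 tensor_map0.
  exists h => x a; apply: hD; exists (tmul x a).
  by rewrite tensor_map_tmul [sh _]tensor_hom_tmul.
pose h c := projT1 (cid (ext c)).
have hE c x a : h c (tmul (f c x) a) = s c x a by exact: (projT2 (cid (ext c))).
have bal c : balanced (fun (y : L c) (a : A c) => h c (tmul y a)).
  by split=> *; rewrite ?tmulDl ?tmulDr ?tmulZ // raddfD.
by exists (Pairing bal).
Qed.

Local Notation E := (terminal A).
Local Notation u := (terminal_pairing A).

Lemma terminal_extension (N L : cart_module R) (f : morphism N L) (g : morphism N E) :
  pure_mono f -> exists h : morphism L E, mor_eq (mor_comp h f) g.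
Proof.
move=> /(pairing_extension (pull g u))[s sE].
have [h hE] := terminal_exists s; exists h; apply: terminal_unique => c x a.
by rewrite [LHS]hE sE.
Qed.

(** To retract f, extend i along f and compose with r. *)
Lemma terminal_retract_pure_injective (P : cart_module R) (i : morphism P E)
    (r : morphism E P) :
  mor_eq (mor_comp r i) (mor_id P) -> pure_injective P.
Proof.
move=> ri M N f g /cart_pure_exact_mono/(terminal_extension i)[h hf].
exists (mor_comp r h) => c x; rewrite -[RHS]ri.
exact: (congr1 (r c) (hf c x)).
Qed.

End Extension.

Definition char_mod (M : rep_module R) c : lmodType (R c) := character (M c).
Local Notation E M := (terminal (char_mod M)).

Definition eval_pairing (M : rep_module R) : pairing (char_mod M) M :=
  Pairing (fun c => @char_eval_balanced _ (M c)).

Lemma embed_exists (M : cart_module R) : exists j : morphism M (E M),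
  forall c x f, terminal_pairing (char_mod M) c (j c x) f = char_val f x.
Proof. exact: (terminal_exists (eval_pairing M)). Qed.

Lemma embed_pure (M : cart_module R) (j : morphism M (E M)) :
  (forall c x f, terminal_pairing (char_mod M) c (j c x) f = char_val f x) ->
  pure_mono j.
Proof.
move=> jE c; have bal := pair_balanced (terminal_pairing (char_mod M)) c.
split; first exact: (detected_injective bal (jE c)).
exact: (detected_tensor_injective bal (jE c)).
Qed.

(** Being pure-injective, P is a retract of the module E attached to its own
    characters, in which it is pure; and maps into E extend. *)
Lemma pure_injective_extension (N L P : cart_module R) (f : morphism N L)
    (g : morphism N P) :
  pure_injective P -> pure_mono f -> exists h : morphism L P, mor_eq (mor_comp h f) g.
Proof.
move=> injP fp; have [j jE] := embed_exists P.
have [K [k /injP[r rj]]] := pure_mono_cokernel (embed_pure jE).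
have [h hf] := terminal_extension (mor_comp j g) fp.
exists (mor_comp r h) => c x; rewrite [RHS](esym (rj c (g c x))).
exact: (congr1 (r c) (hf c x)).
Qed.

End PureMonos.

(** * Minimal idempotents of compact monoids *)

Section CompactMonoid.
Variables (T : Type) (mul : T -> T -> T) (closed : (T -> Prop) -> Prop).
Local Notation "f * g" := (mul f g).
Hypotheses (mulA : associative mul)
  (closed_nonempty : forall Z, closed Z -> exists f, Z f)
  (closed_chain : forall F : (T -> Prop) -> Prop, (exists Z, F Z) ->
    (forall Z, F Z -> closed Z) ->
    (forall Z Z', F Z -> F Z' ->
      (forall f, Z f -> Z' f) \/ (forall f, Z' f -> Z f)) ->
    closed (fun f => forall Z, F Z -> Z f))
  (closed_image : forall Z g, closed Z -> closed (fun f => exists2 z, Z z & z * g = f))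
  (closed_fiber : forall Z g p t, closed Z -> Z t -> t * g = p ->
    closed (fun f => Z f /\ f * g = p)).

(** Zorn's lemma for reverse inclusion, among the closed subsets of Z0 with a
    property Q that passes to intersections. *)
Lemma closed_minimal (Q : (T -> Prop) -> Prop) (Z0 : T -> Prop) :
    (forall F : (T -> Prop) -> Prop,
      (forall Z, F Z -> Q Z) -> Q (fun f => forall Z, F Z -> Z f)) ->
    closed Z0 -> Q Z0 ->
  exists Z, [/\ closed Z, Q Z, forall f, Z f -> Z0 f &
    forall Z', closed Z' -> Q Z' -> (forall f, Z' f -> Z f) ->
      forall f, Z f -> Z' f].
Proof.
move=> Qcap clZ0 QZ0.
pose P (Z : T -> Prop) := [/\ closed Z, Q Z & forall f, Z f -> Z0 f].
pose le (A B : {Z | P Z}) := `[< forall f, sval B f -> sval A f >].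
have [||||[Z [clZ QZ ZZ0]] Zmin] := @Zorn {Z | P Z} le.
- by move=> A; apply/asboolP.
- by move=> A B D /asboolP AB /asboolP BD; apply/asboolP => f /BD/AB.
- move=> [A PA] [B PB] /asboolP AB /asboolP BA; apply/eq_exist/funext => f.
  by apply/propext; split; [apply: BA | apply: AB].
- move=> F Ftot; case: (pselect (exists A, F A)) => [[A0 FA0]|nF]; last first.
    by exists (exist P Z0 (And3 clZ0 QZ0 (fun _ => id))) => A FA; case: nF; exists A.
  pose F' Z := exists2 A, F A & sval A = Z.
  have PF : P (fun f => forall Z, F' Z -> Z f).
    split.
    + apply: closed_chain; first by exists (sval A0), A0.
        by move=> _ [A FA <-]; have [] := svalP A.
      move=> _ _ [A FA <-] [B FB <-].
      by case: (Ftot A B FA FB) => /asboolP le'; [right|left].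
    + by apply: Qcap => _ [A FA <-]; have [] := svalP A.
    + move=> f Ff; have [_ _] := svalP A0; apply; apply: Ff.
      by exists A0.
  exists (exist P _ PF) => A FA; apply/asboolP => f; apply.
  by exists A.
exists Z; split=> // Z' clZ' QZ' Z'Z f.
have PZ' : P Z' by split=> // g /Z'Z/ZZ0.
have := Zmin (exist P Z' PZ'); move=> /(_ (asboolT Z'Z)) /(congr1 sval) /= ->.
by [].
Qed.

(** The argument of Ellis and Numakura.  Let L be a minimal closed left ideal of
    S, and K a minimal closed subsemigroup of L.  For e in K, minimality gives
    K e = K, so the elements k of K with k e = e form a closed subsemigroup,
    which again is all of K; thus e e = e.  For f in S, the set S f e is a
    closed left ideal inside L, hence equal to L, and so contains e. *)
Lemma minimal_idempotent (S : T -> Prop) : closed S ->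
    (forall f g, S f -> S g -> S (f * g)) ->
  exists e, [/\ S e, e * e = e &
    forall f, S f -> exists2 g, S g & g * (f * e) = e].
Proof.
move=> clS SM.
have [||L [clL SL LS Lmin]] :=
    @closed_minimal (fun L => forall f g, S f -> L g -> L (f * g)) S _ clS _.
- by move=> F FQ f g Sf Lg Z FZ; apply: (FQ _ FZ) => //; apply: Lg.
- exact: SM.
have [||K [clK KK KL Kmin]] :=
    @closed_minimal (fun K => forall f g, K f -> K g -> K (f * g)) L _ clL _.
- by move=> F FQ f g Kf Kg Z FZ; apply: (FQ _ FZ); [apply: Kf | apply: Kg].
- by move=> f g /LS; apply: SL.
have [e Ke] := closed_nonempty clK.
have [k Kk ke] : exists2 k, K k & k * e = e.
  apply: (Kmin (fun f => exists2 k, K k & k * e = f)) => //.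
  - exact: closed_image.
  - move=> _ _ [k Kk <-] [k' Kk' <-]; exists (k * e * k'); last by rewrite !mulA.
    exact: KK (KK _ _ Kk Ke) Kk'.
  - by move=> _ [k Kk <-]; apply: KK.
have [_ ee] : K e /\ e * e = e.
  apply: (Kmin (fun f => K f /\ f * e = e)) => //.
  - exact: closed_fiber clK Kk ke.
  - by move=> f g [Kf fe] [Kg ge]; split; [apply: KK | rewrite -mulA ge].
  - by move=> f [].
have Le := KL _ Ke; exists e; split=> //; first exact: LS.
move=> f Sf; apply: (Lmin (fun z => exists2 g, S g & g * (f * e) = z)) => //.
- exact: closed_image.
- move=> g _ Sg [h Sh <-]; exists (g * h); first exact: SM.
  by rewrite -mulA.
- by move=> _ [g Sg <-]; apply: (SL _ _ Sg); apply: SL.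
Qed.

End CompactMonoid.

(** * Compactness of spaces of characters *)

Section DualTopology.
Variables (T O : Type) (mul : T -> T -> T) (G : O -> zmodType).
Variables (ev : T -> forall c, {additive G c -> QmodZ}).
Variables (act : T -> forall c, {additive G c -> G c}).
Hypotheses (ev_mul : forall f g c b, ev (mul f g) c b = ev f c (act g c b))
  (ev_inj : forall f g, (forall c b, ev f c b = ev g c b) -> f = g)
  (ev_surj : forall h : (forall c, {additive G c -> QmodZ}),
    exists f, forall c b, ev f c b = h c b).

Definition agree (Z : T -> Prop) c (b : G c) :=
  forall f g, Z f -> Z g -> ev f c b = ev g c b.

(** Closed sets are the nonempty fibres of restriction to a family of subgroups
    of the G_c.  Taking for these subgroups the largest possible ones, the loci
    of agreement, makes inclusion of closed sets reverse inclusion of loci. *)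
Definition dual_closed (Z : T -> Prop) := (exists f, Z f) /\
  forall f, (forall c (b : G c), agree Z b -> forall g, Z g ->
    ev f c b = ev g c b) -> Z f.

Lemma agree_sub (Z Z' : T -> Prop) c (b : G c) :
  (forall f, Z f -> Z' f) -> agree Z' b -> agree Z b.
Proof. by move=> ZZ' ag f g /ZZ' Zf /ZZ' Zg; apply: ag. Qed.

Lemma agreeB Z c (b b' : G c) : agree Z b -> agree Z b' -> agree Z (b - b').
Proof. by move=> ab ab' f g Zf Zg; rewrite !raddfB (ab f g) // (ab' f g). Qed.

Lemma agree0 Z c : agree Z (0 : G c).
Proof. by move=> f g _ _; rewrite !raddf0. Qed.

Lemma ev_extend (D : forall c, G c -> QmodZ -> Prop) :
    (forall c, partial_hom (D c)) ->
  exists f, forall c b t, D c b t -> ev f c b = t.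
Proof.
move=> hD; pose h c := projT1 (cid (QmodZ_injective (hD c))).
have [f fE] := ev_surj h; exists f => c b t Dbt; rewrite fE.
exact: (projT2 (cid (QmodZ_injective (hD c)))).
Qed.

(** The common values of the members of F on their loci of agreement form a
    partial homomorphism on the union of these loci; any extension of it
    belongs to all members. *)
Lemma dual_closed_chain (F : (T -> Prop) -> Prop) : (exists Z, F Z) ->
    (forall Z, F Z -> dual_closed Z) ->
    (forall Z Z', F Z -> F Z' ->
      (forall f, Z f -> Z' f) \/ (forall f, Z' f -> Z f)) ->
  dual_closed (fun f => forall Z, F Z -> Z f).
Proof.
move=> [Z0 FZ0] Fcl Ftot.
pose D c (b : G c) t := exists Z f, [/\ F Z, Z f, agree Z b & t = ev f c b].
have [c|f fD] := @ev_extend D.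
  split.
  - have [[f Zf] _] := Fcl _ FZ0; exists Z0, f; split=> //; last by rewrite raddf0.
    exact: agree0.
  - move=> b b' _ _ [Z [f [FZ Zf ab ->]]] [Z' [f' [FZ' Zf' ab' ->]]].
    case: (Ftot Z Z' FZ FZ') => sub.
      exists Z, f; rewrite raddfB (ab' f' f) //; last exact: sub.
      by split=> //; apply: agreeB => //; apply: agree_sub ab'.
    exists Z', f'; rewrite raddfB (ab f f') //; last exact: sub.
    by split=> //; apply: agreeB => //; apply: agree_sub ab.
  - by move=> _ [Z [f [_ _ _ ->]]]; rewrite raddf0.
have Ff Z : F Z -> Z f.
  move=> FZ; have [_ Zcl] := Fcl _ FZ; apply: Zcl => c b ab g Zg.
  by apply: fD; exists Z, g.
split; first by exists f.
move=> g gE Z FZ; have [_ Zcl] := Fcl _ FZ; apply: Zcl => c b ab h Zh.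
rewrite (ab h f) //; last exact: Ff.
by apply: gE => //; apply: agree_sub ab => h' /(_ Z FZ).
Qed.

(** Let f agree with Z g wherever possible.  Then f a, as a function of g a, and
    the common values of Z on its locus of agreement fit together: where g a
    lies in that locus, a lies in the locus of Z g, and f a is forced.  An
    extension z of the resulting partial homomorphism is in Z, and z g = f. *)
Lemma dual_closed_image Z g :
  dual_closed Z -> dual_closed (fun f => exists2 z, Z z & mul z g = f).
Proof.
move=> [[z0 Zz0] Zcl]; split; first by exists (mul z0 g), z0.
move=> f fE.
pose D c (y : G c) t := exists a b,
  [/\ agree Z b, y = act g c a + b & t = ev f c a + ev z0 c b].
have [c|z zD] := @ev_extend D.
  split.
  - by exists 0, 0; rewrite !raddf0 !addr0; split=> //; apply: agree0.
  - move=> _ _ _ _ [a [b [ab -> ->]]] [a' [b' [ab' -> ->]]].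
    exists (a - a'), (b - b'); rewrite !raddfB !opprD ![_ + _ + (- _ - _)]addrACA.
    by split=> //; apply: agreeB.
  - move=> t [a [b [ab /esym/eqP]]]; rewrite addr_eq0 => /eqP Ea ->.
    rewrite (fE _ _ _ (mul z0 g)); last by exists z0.
      by rewrite ev_mul Ea raddfN addNr.
    by move=> _ _ [z Zz <-] [z' Zz' <-]; rewrite !ev_mul Ea !raddfN (ab z z').
exists z.
  apply: Zcl => c b ab h Zh; rewrite (ab h z0) //; apply: zD.
  by exists 0, b; rewrite !raddf0 !add0r.
apply: ev_inj => c a; rewrite ev_mul; apply: zD.
by exists a, 0; rewrite raddf0 !addr0; split=> //; apply: agree0.
Qed.

Lemma dual_closed_fiber Z g p t : dual_closed Z -> Z t -> mul t g = p ->
  dual_closed (fun f => Z f /\ mul f g = p).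
Proof.
move=> [_ Zcl] Zt tg; split; first by exists t.
move=> f fE; split.
  apply: Zcl => c b ab h Zh; rewrite (ab h t) //; apply: fE => //.
  by apply: agree_sub ab => h' [].
apply: ev_inj => c b; rewrite -tg !ev_mul; apply: fE => //.
by move=> h h' [_ hg] [_ hg']; rewrite -!ev_mul hg hg'.
Qed.

End DualTopology.

(** * Idempotent endomorphisms and the envelope *)

Lemma linear_ext (R : pzRingType) (U V : lmodType R) (f g : {linear U -> V}) :
  f =1 g -> f = g.
Proof.
case: f g => [f [[fD] [fZ]]] [g [[gD] [gZ]]] /= /funext fg; subst g.
by rewrite (Prop_irrelevance fD gD) (Prop_irrelevance fZ gZ).
Qed.

Section Envelope.
Context (C : category) (R : representation C).

Lemma mor_ext (N L : rep_module R) (f g : morphism N L) : mor_eq f g -> f = g.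
Proof.
case: f g => [f fN] [g gN] fg.
have E : f = g by apply: functional_extensionality_dep => c; apply/linear_ext/fg.
by subst g; congr Morphism; apply: Prop_irrelevance.
Qed.

(** Over a general representation the cartesian modules need not be closed under
    kernels, but they are under retracts. *)
Lemma retract_cartesian (N : rep_module R) (L : cart_module R) (i : morphism N L)
    (r : morphism L N) : mor_eq (mor_comp r i) (mor_id N) -> cartesian N.
Proof.
move=> ri; apply: cartesianI => [c d a y|c d a t at0].
  rewrite -[y]/(mor_id N d y) -ri.
  exact: (spanned_nat (f := r) (fun _ => id) (cartesian_spanned a (i d y))).
have it0 : tensor_map (i c) _ t = 0.
  by apply: (@cartesian_inj _ _ L _ _ a); rewrite adjoint_hom_nat at0 linear0 raddf0.
rewrite -[LHS](@tensor_map_id _ _ _ (mor_comp r i c) (ri c)).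
by rewrite -(@tensor_map_comp _ _ _ _ _ (r c) (i c)) // it0 tensor_map0.
Qed.

Section Idempotent.
Variables (L : cart_module R) (e : morphism L L).
Hypothesis ee : mor_comp e e = e.

Let fixed c (x : L c) := e c x = x.

Fact fixed0 c : @fixed c 0.
Proof. exact: linear0. Qed.

Fact fixedZD c (a : (R c)^c) (x y : L c) :
  fixed x -> fixed y -> fixed (a *: x + y).
Proof. by rewrite /fixed linearP => -> ->. Qed.

Fact fixed_map c d (a : hom c d) (x : L c) : fixed x -> fixed (mod_map L a x : L d).
Proof. by rewrite /fixed mor_nat => ->. Qed.

Definition fixed_submodule : submodule L :=
  @Submodule _ _ L (fun c => Submod (@fixed0 c) (@fixedZD c)) fixed_map.

Fact fixed_image c (x : L c) : fixed_submodule c (e c x).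
Proof. exact: (congr1 (fun f : morphism L L => f c x) ee). Qed.

Lemma idempotent_splits :
  exists (E : cart_module R) (i : morphism E L) (r : morphism L E),
  mor_comp r i = mor_id E /\ mor_comp i r = e.
Proof.
pose i := sub_rep_incl fixed_submodule; pose r := sub_rep_corestrict fixed_image.
have ri : mor_eq (mor_comp r i) (mor_id _).
  move=> c x; apply: sub_incl_inj.
  exact: (@sub_inclP _ _ (fixed_submodule c) x).
exists (CartModule (retract_cartesian ri)), i, r; split; first exact: mor_ext ri.
exact: mor_ext.
Qed.

End Idempotent.

Section EndCompact.
Variable A : forall c, lmodType (R c).
Local Notation E := (terminal A).
Local Notation u := (terminal_pairing A).

Definition end_ev (f : morphism E E) c : {additive tensor (E c) (A c) -> QmodZ} :=
  tensor_hom (pair_balanced (pull f u) c).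

Definition end_act (f : morphism E E) c :
    {additive tensor (E c) (A c) -> tensor (E c) (A c)} := tensor_map (f c) (A c).

Lemma end_ev_tmul f c x a : end_ev f c (tmul x a) = u c (f c x) a.
Proof. exact: tensor_hom_tmul. Qed.

Lemma end_ev_mul f g c b : end_ev (mor_comp f g) c b = end_ev f c (end_act g c b).
Proof.
apply: (tensor_additive_eq (f := end_ev (mor_comp f g) c)
  (g := end_ev f c \o end_act g c)) => x a.
rewrite [LHS]end_ev_tmul.
rewrite -[RHS]/(end_ev f c (tensor_map (g c) (A c) (tmul x a))).
by rewrite tensor_map_tmul end_ev_tmul.
Qed.

Lemma end_ev_inj f g : (forall c b, end_ev f c b = end_ev g c b) -> f = g.
Proof.
move=> fg; apply/mor_ext/terminal_unique => c x a.
by rewrite -!end_ev_tmul fg.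
Qed.

Lemma end_ev_surj (h : forall c, {additive tensor (E c) (A c) -> QmodZ}) :
  exists f, forall c b, end_ev f c b = h c b.
Proof.
have bal c : balanced (fun (x : E c) (a : A c) => h c (tmul x a)).
  by split=> *; rewrite ?tmulDl ?tmulDr ?tmulZ // raddfD.
have [f fE] := terminal_exists (Pairing bal); exists f => c.
by apply: tensor_additive_eq => x a; rewrite end_ev_tmul fE.
Qed.

(** The morphisms f with f j = j form a closed set: they are determined by their
    pairing at the elements j x (x) a, and at these all of them agree. *)
Lemma end_minimal_idempotent (N : cart_module R) (j : morphism N E) :
  exists e : morphism E E, [/\ mor_comp e j = j, mor_comp e e = e &
    forall f, mor_comp f j = j ->
      exists2 g, mor_comp g j = j & mor_comp g (mor_comp f e) = e].
Proof.
apply: (@minimal_idempotent _ (@mor_comp _ _ E E E) (dual_closed end_ev)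
  _ _ _ _ _ (fun f => mor_comp f j = j)).
- by move=> f g h; apply: mor_ext.
- by move=> Z [].
- exact: (dual_closed_chain end_ev_surj).
- exact: (dual_closed_image end_ev_mul end_ev_inj end_ev_surj).
- exact: (dual_closed_fiber end_ev_mul end_ev_inj).
- split; first by exists (mor_id E); apply: mor_ext.
  move=> f fE; apply/mor_ext/terminal_unique => c x a.
  rewrite -[LHS]end_ev_tmul (fE _ _ _ (mor_id E)); last by apply: mor_ext.
    by rewrite end_ev_tmul.
  move=> g h gj hj; rewrite !end_ev_tmul -[g c _]/(mor_comp g j c x) gj.
  by rewrite -[h c _]/(mor_comp h j c x) hj.
- by move=> f g fj gj; rewrite -[in RHS]fj -[in RHS]gj; apply: mor_ext.
Qed.

End EndCompact.

Lemma mor_compA (N L K J : rep_module R) (h : morphism K J) (g : morphism L K)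
  (f : morphism N L) : mor_comp h (mor_comp g f) = mor_comp (mor_comp h g) f.
Proof. exact: mor_ext. Qed.

Lemma mor_comp1 (N L : rep_module R) (f : morphism N L) : mor_comp f (mor_id N) = f.
Proof. exact: mor_ext. Qed.

Lemma mor_1comp (N L : rep_module R) (f : morphism N L) : mor_comp (mor_id L) f = f.
Proof. exact: mor_ext. Qed.

End Envelope.

Theorem theorem5p4 (C : category) (R : representation C) (M : cart_module R) :
  exists (E : cart_module R) (phi : morphism M E),
    pure_injective_envelope phi.
Proof.
have [j jE] := embed_exists M.
have [e [ej ee emin]] := end_minimal_idempotent j.
have [E [i [r [ri ir]]]] := idempotent_splits ee.
pose phi := mor_comp r j.
have iphi : mor_comp i phi = j by rewrite /phi mor_compA ir ej.
exists E, phi; split.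
- by apply: (@terminal_retract_pure_injective _ _ _ _ i r); rewrite ri.
- move=> P psi injP; apply: pure_injective_extension => //.
  apply: (@pure_mono_cancel _ _ _ _ _ phi i j _ (embed_pure jE)) => c x.
  by rewrite -iphi.
have left_inverse (f : morphism E E) : mor_comp f phi = phi ->
    exists2 g, mor_comp g phi = phi & mor_comp g f = mor_id E.
  move=> fphi; pose f' := mor_comp i (mor_comp f r).
  have f'j : mor_comp f' j = j.
    by rewrite /f' -!mor_compA -/phi fphi.
  have f'i : mor_comp f' i = mor_comp i f by rewrite /f' -!mor_compA ri mor_comp1.
  move: f' f'j f'i => f' f'j f'i; have [g gj gfe] := emin f' f'j.
  exists (mor_comp r (mor_comp g i)).
    by rewrite -!mor_compA iphi gj.
  have ei : mor_comp e i = i by rewrite -ir -mor_compA ri mor_comp1.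
  have : mor_comp (mor_comp g (mor_comp f' e)) i = i by rewrite gfe.
  by rewrite -!mor_compA ei f'i => ->.
move=> f /mor_ext fphi; have [g gphi gf] := left_inverse f fphi.
have [h _ hg] := left_inverse g gphi.
exists g; rewrite gf; split=> //.
by rewrite -[f]mor_1comp -hg -!mor_compA (mor_compA g f) gf mor_1comp hg.
Qed.
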